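(* Let $X$ be a finite set, and let $S$ and $T$ be two finite subsets of $Di[X]$. The problem whether $Id(S)$ and $Id(T)$ are identical is algorithmically solvable.
   Context: Fix a field $\mathbf{k}$ (algorithms are understood to treat field operations and equality tests in $\mathbf{k}$ as elementary steps). A commutative dialgebra is a $\mathbf{k}$-linear space with two bilinear operations $\vdash,\dashv$, each associative and commutative, satisfying $a\dashv(b\vdash c)=a\dashv(b\dashv c)$, $(a\dashv b)\vdash c=(a\vdash b)\vdash c$, $a\vdash(b\dashv c)=(a\vdash b)\dashv c$. An ideal is a subspace closed under multiplication (by $\vdash$ and by $\dashv$) with arbitrary elements; $Id(S)$ is the ideal of $Di[X]$ generated by $S$. Let $X$ be a totally ordered set and $\lfloor X^+\rfloor$ the free commutative semigroup without unit on $X$ (elements $\lfloor u\rfloor$, length $|u|$). Let $\lfloor X^+\rfloor_1=\{\lfloor u\rfloor_1\mid\lfloor u\rfloor\in\lfloor X^+\rfloor\}$ and $\lfloor XX\rfloor_2=\{\lfloor v\rfloor_2\mid\lfloor v\rfloor\in\lfloor X^+\rfloor,|v|=2\}$ (formal symbols); $x\in X$ is identified with $\lfloor x\rfloor_1$. $Di[X]$ is the free commutative dialgebra generated by $X$: the $\mathbf{k}$-space with basis $\lfloor X^+\rfloor_1\cup\lfloor XX\rfloor_2$ and operations: for $x,x'\in X$, $x\dashv x'=\lfloor xx'\rfloor_1$, $x\vdash x'=\lfloor xx'\rfloor_2$; and if $|uv|>2$, $\lfloor u\rfloor_p\vdash\lfloor v\rfloor_q=\lfloor u\rfloor_p\dashv\lfloor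 v\rfloor_q=\lfloor uv\rfloor_1$. ''Algorithmically solvable'' means that there is an algorithm which, given $S$ and $T$, decides whether $Id(S)=Id(T)$. *)

(* Defs.v *)
From HB Require Import structures.
From mathcomp Require Import all_boot all_order all_algebra finmap.
From mathcomp.multinomials Require Import monalg.

Set Implicit Arguments.
Unset Strict Implicit.
Unset Printing Implicit Defensive.

Import GRing.Theory.

Local Open Scope fset_scope.
Local Open Scope ring_scope.

Section Dialgebra.
Variables (k : fieldType) (V : lmodType k).
Implicit Types (vd dv : V -> V -> V) (I : V -> Prop).

Definition bilinear_op (m : V -> V -> V) : Prop :=
  (forall (c : k) (a a' b : V), m (c *: a + a') b = c *: m a b + m a' b) /\
  (forall (c : k) (a b b' : V), m a (c *: b + b') = c *: m a b + m a b').

(* vd is the product |- and dv is the product -| *)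
Record comm_dialgebra vd dv : Prop := CommDialgebra {
  vd_bilinear : bilinear_op vd;
  dv_bilinear : bilinear_op dv;
  vdA : associative vd;
  dvA : associative dv;
  vdC : commutative vd;
  dvC : commutative dv;
  dv_vd : forall a b c, dv a (vd b c) = dv a (dv b c);
  vd_dv : forall a b c, vd (dv a b) c = vd (vd a b) c;
  vd_dvA : forall a b c, vd a (dv b c) = dv (vd a b) c
}.

Record di_ideal vd dv I : Prop := DiIdeal {
  ideal0 : I 0;
  idealD : forall a b, I a -> I b -> I (a + b);
  idealZ : forall (c : k) a, I a -> I (c *: a);
  ideal_vdl : forall a b, I a -> I (vd a b);
  ideal_vdr : forall a b, I a -> I (vd b a);
  ideal_dvl : forall a b, I a -> I (dv a b);
  ideal_dvr : forall a b, I a -> I (dv b a)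
}.

Definition gen_ideal vd dv (S : V -> Prop) (f : V) : Prop :=
  forall I, di_ideal vd dv I -> (forall s, S s -> I s) -> I f.

End Dialgebra.

Section Symbols.
Variable X : choiceType.

Definition csg : Type := {u : {cmonom X} | (0 < mdeg u)%N}.
HB.instance Definition _ := Choice.on csg.

Definition csg_len (u : csg) : nat := mdeg (val u).

Lemma csg_mul_proof (u v : csg) : (0 < mdeg (mmul (val u) (val v)))%N.
Proof. by rewrite mdegM addn_gt0 (valP u). Qed.

Definition csg_mul (u v : csg) : csg := Sub (mmul (val u) (val v)) (csg_mul_proof u v).

Definition csg2 : Type := {v : csg | csg_len v == 2%N}.
HB.instance Definition _ := Choice.on csg2.

(* [inl u] is the symbol [u]_1 and [inr v] is the symbol [v]_2, |v| = 2. *)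
Definition dsym : Type := (csg + csg2)%type.
HB.instance Definition _ := Choice.on dsym.

Definition dsym_word (a : dsym) : csg :=
  match a with inl u => u | inr v => val v end.

Definition dsym_dv (a b : dsym) : dsym := inl (csg_mul (dsym_word a) (dsym_word b)).

(* The product of two words has length 2 exactly when both words are letters,
   which is the only case in which |- yields a symbol of the second kind. *)
Definition dsym_vd (a b : dsym) : dsym :=
  let w := csg_mul (dsym_word a) (dsym_word b) in
  match insub w : option csg2 with Some v => inr v | None => inl w end.

End Symbols.

Notation Di k X := {malg k[dsym X]}.

Section FreeDialgebra.
Variables (k : fieldType) (X : choiceType).

Definition bilin_ext (m : dsym X -> dsym X -> dsym X) (f g : Di k X) : Di k X :=
  \sum_(a <- msupp f) \sum_(b <- msupp g) << f@_a * g@_b *g m a b >>.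

Definition di_vd : Di k X -> Di k X -> Di k X := bilin_ext (@dsym_vd X).
Definition di_dv : Di k X -> Di k X -> Di k X := bilin_ext (@dsym_dv X).

Definition Id (S : {fset Di k X}) : Di k X -> Prop :=
  gen_ideal di_vd di_dv (fun s => s \in S).

End FreeDialgebra.

Section FreeDialgebraTheory.
Variables (k : fieldType) (X : choiceType).
Implicit Types (m : dsym X -> dsym X -> dsym X) (f g h : {malg k[dsym X]}).

Lemma bilin_extw m (d1 d2 : {fset dsym X}) f g :
  msupp f `<=` d1 -> msupp g `<=` d2 ->
  bilin_ext m f g = \sum_(a <- d1) \sum_(b <- d2) << f@_a * g@_b *g m a b >>.
Proof.
move=> le1 le2; rewrite /bilin_ext (big_fset_incl _ le1) /=.
  apply: eq_bigr => a _; apply: big_fset_incl => // b _ /mcoeff_outdom ->.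
  by rewrite mulr0 monalgU0.
move=> a _ /mcoeff_outdom fa.
by rewrite big1 // => b _; rewrite fa mul0r monalgU0.
Qed.

Lemma monalgUZ (c x : k) (a : dsym X) : << c * x *g a >> = c *: << x *g a >>.
Proof. by apply/malgP => b; rewrite mcoeffZ !mcoeffU mulrnAr. Qed.

Lemma bilin_ext_bilinear m : bilinear_op (V := Di k X) (bilin_ext m).
Proof.
split=> c f f' g.
- set d := msupp f `|` msupp f'.
  have le1 : msupp (c *: f + f') `<=` d.
    apply: fsubset_trans (msuppD_le _ _) _.
    exact: fsetSU (msuppZ_le _ _).
  rewrite (bilin_extw m le1 (fsubset_refl _)).
  rewrite (bilin_extw m (fsubsetUl _ _ : msupp f `<=` d) (fsubset_refl _)).
  rewrite (bilin_extw m (fsubsetUr _ _ : msupp f' `<=` d) (fsubset_refl _)).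
  rewrite scaler_sumr -big_split /=; apply: eq_bigr => a _.
  rewrite scaler_sumr -big_split /=; apply: eq_bigr => b _.
  by rewrite mcoeffD mcoeffZ mulrDl monalgUD -mulrA monalgUZ.
- set d := msupp f' `|` msupp g.
  have le1 : msupp (c *: f' + g) `<=` d.
    apply: fsubset_trans (msuppD_le _ _) _.
    exact: fsetSU (msuppZ_le _ _).
  rewrite (bilin_extw m (fsubset_refl _) le1).
  rewrite (bilin_extw m (fsubset_refl _) (fsubsetUl _ _ : msupp f' `<=` d)).
  rewrite (bilin_extw m (fsubset_refl _) (fsubsetUr _ _ : msupp g `<=` d)).
  rewrite scaler_sumr -big_split /=; apply: eq_bigr => a _.
  rewrite scaler_sumr -big_split /=; apply: eq_bigr => b _.
  by rewrite mcoeffD mcoeffZ mulrDr monalgUD mulrCA (monalgUZ c).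
Qed.

Lemma bilin_extUU m (c d : k) (a b : dsym X) :
  bilin_ext m << c *g a >> << d *g b >> = << c * d *g m a b >>.
Proof.
by rewrite (bilin_extw m msuppU_le msuppU_le) !big_seq_fset1 !mcoeffUU.
Qed.

Lemma bilin_ext_suml m (r : seq (dsym X)) (F : dsym X -> Di k X) g :
  bilin_ext m (\sum_(a <- r) F a) g = \sum_(a <- r) bilin_ext m (F a) g.
Proof.
have [lm _] := bilin_ext_bilinear m.
elim: r => [|a r IH]; first by rewrite !big_nil /bilin_ext msupp0 big_seq_fset0.
by rewrite !big_cons -IH -[F a]scale1r lm !scale1r.
Qed.

Lemma bilin_ext_sumr m (r : seq (dsym X)) (F : dsym X -> Di k X) g :
  bilin_ext m g (\sum_(a <- r) F a) = \sum_(a <- r) bilin_ext m g (F a).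
Proof.
have [_ rm] := bilin_ext_bilinear m.
elim: r => [|a r IH].
  by rewrite !big_nil /bilin_ext big1 // => b _; rewrite msupp0 big_seq_fset0.
by rewrite !big_cons -IH -[F a]scale1r rm !scale1r.
Qed.

Lemma bilin_ext_lr m1 m2 m3 m4 :
  (forall a b c, m1 a (m2 b c) = m3 (m4 a b) c) ->
  forall f g h, bilin_ext m1 f (bilin_ext m2 g h) =
                bilin_ext m3 (bilin_ext m4 f g) h.
Proof.
move=> E f g h; rewrite [f]monalgE (bilin_ext_suml m1) (bilin_ext_suml m4).
rewrite (bilin_ext_suml m3); apply: eq_bigr => a _.
rewrite [g]monalgE (bilin_ext_suml m2) (bilin_ext_sumr m1) (bilin_ext_sumr m4).
rewrite (bilin_ext_suml m3); apply: eq_bigr => b _.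
rewrite [h]monalgE (bilin_ext_sumr m2) (bilin_ext_sumr m1) (bilin_ext_sumr m3).
apply: eq_bigr => c _.
by rewrite !bilin_extUU E mulrA.
Qed.

Lemma bilin_ext_rr m1 m2 m3 m4 :
  (forall a b c, m1 a (m2 b c) = m3 a (m4 b c)) ->
  forall f g h, bilin_ext m1 f (bilin_ext m2 g h) =
                bilin_ext m3 f (bilin_ext m4 g h).
Proof.
move=> E f g h; rewrite [f]monalgE (bilin_ext_suml m1) (bilin_ext_suml m3).
apply: eq_bigr => a _; rewrite [g]monalgE (bilin_ext_suml m2) (bilin_ext_suml m4).
rewrite (bilin_ext_sumr m1) (bilin_ext_sumr m3); apply: eq_bigr => b _.
rewrite [h]monalgE (bilin_ext_sumr m2) (bilin_ext_sumr m4).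
rewrite (bilin_ext_sumr m1) (bilin_ext_sumr m3); apply: eq_bigr => c _.
by rewrite !bilin_extUU E.
Qed.

Lemma bilin_extC m : commutative m ->
  forall f g, bilin_ext m f g = bilin_ext m g f.
Proof.
move=> C f g; rewrite /bilin_ext exchange_big /=.
by apply: eq_bigr => a _; apply: eq_bigr => b _; rewrite mulrC C.
Qed.

Lemma csg_mulA : associative (@csg_mul X).
Proof. by move=> u v w; apply: val_inj; exact: mulmA. Qed.

Lemma csg_mulC : commutative (@csg_mul X).
Proof. by move=> u v; apply: val_inj; exact: mulmC. Qed.

Lemma dsym_word_vd (a b : dsym X) :
  dsym_word (dsym_vd a b) = csg_mul (dsym_word a) (dsym_word b).
Proof. by rewrite /dsym_vd; case: insubP => //= u _ ->. Qed.

Lemma dsym_vd_long (a b c : dsym X) :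
  dsym_word b = csg_mul (dsym_word a) (dsym_word c) ->
  forall d, dsym_vd d b = inl (csg_mul (dsym_word d) (dsym_word b)).
Proof.
move=> E d; rewrite /dsym_vd insubN //.
rewrite E /csg_len /= !mdegM.
by move: (valP (dsym_word a)) (valP (dsym_word c)) (valP (dsym_word d));
   case: (mdeg _) => // x; case: (mdeg _) => // y; case: (mdeg _) => // z;
   rewrite !addSn !addnS.
Qed.

Lemma dsym_vdC : commutative (@dsym_vd X).
Proof. by move=> a b; rewrite /dsym_vd csg_mulC. Qed.

Theorem Di_comm_dialgebra :
  comm_dialgebra (V := Di k X) (@di_vd k X) (@di_dv k X).
Proof.
split; try exact: bilin_ext_bilinear.
- apply: bilin_ext_lr => a b c; rewrite [RHS]dsym_vdC.
  rewrite !(dsym_vd_long (dsym_word_vd _ _)) !dsym_word_vd.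
  by rewrite csg_mulA csg_mulC.
- by apply: bilin_ext_lr => a b c; rewrite /dsym_dv /= csg_mulA.
- exact: bilin_extC dsym_vdC.
- by apply: bilin_extC => a b; rewrite /dsym_dv csg_mulC.
- by apply: bilin_ext_rr => a b c; rewrite /dsym_dv dsym_word_vd.
- move=> f g h; rewrite /di_vd /di_dv -[LHS](bilin_extC dsym_vdC).
  rewrite -[RHS](bilin_extC dsym_vdC); apply: bilin_ext_rr => a b c.
  rewrite (dsym_vd_long (dsym_word_vd _ _)) dsym_word_vd.
  by rewrite (@dsym_vd_long b _ c).
- apply: bilin_ext_lr => a b c.
  by rewrite (@dsym_vd_long b _ c) // /dsym_dv dsym_word_vd /= csg_mulA.
Qed.

End FreeDialgebraTheory.

(* Programs handle natural numbers, Booleans and elements of an abstract field,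
   together with pairs and finite lists of such data.  Field elements are
   accessible only through 0, 1, the field operations (with 0^-1 = 0) and the
   equality test. *)

Inductive ty : Type :=
| TNat | TBool | TField | TPair of ty & ty | TList of ty.

Inductive prog : ty -> ty -> Type :=
| PId A : prog A A
| PComp A B C of prog A B & prog B C : prog A C
| PPair A B C of prog A B & prog A C : prog A (TPair B C)
| PFst A B : prog (TPair A B) A
| PSnd A B : prog (TPair A B) B
| PTrue A : prog A TBool
| PFalse A : prog A TBool
| PIf A B of prog A TBool & prog A B & prog A B : prog A B
| PZero A : prog A TNat
| PSucc : prog TNat TNat
| PNatRec A B of prog A B & prog (TPair A (TPair TNat B)) B :
    prog (TPair A TNat) B
| PNil A B : prog A (TList B)
| PCons A : prog (TPair A (TList A)) (TList A)
| PListRec A B C of prog A B & prog (TPair A (TPair C (TPair (TList C) B))) B :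
    prog (TPair A (TList C)) B
| PField0 A : prog A TField
| PField1 A : prog A TField
| PAdd : prog (TPair TField TField) TField
| POpp : prog TField TField
| PMul : prog (TPair TField TField) TField
| PInv : prog TField TField
| PEq : prog (TPair TField TField) TBool
| PWhile A of prog A TBool & prog A A : prog A A.

Section Semantics.
Variable k : fieldType.

Fixpoint den (A : ty) : Type :=
  match A with
  | TNat => nat
  | TBool => bool
  | TField => k
  | TPair A B => (den A * den B)%type
  | TList A => seq (den A)
  end.

Inductive while_rel (A : Type) (test : A -> bool -> Prop) (body : A -> A -> Prop) :
    A -> A -> Prop :=
| while_stop a : test a false -> while_rel test body a a
| while_step a a' a'' : test a true -> body a a' ->
    while_rel test body a' a'' -> while_rel test body a a''.

Fixpoint natrec_rel (B : Type) (base : B -> Prop) (step : nat -> B -> B -> Prop)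
    (n : nat) (b : B) : Prop :=
  match n with
  | 0%N => base b
  | n'.+1 => exists2 b', natrec_rel base step n' b' & step n' b' b
  end.

Fixpoint listrec_rel (B C : Type) (base : B -> Prop)
    (step : C -> seq C -> B -> B -> Prop) (l : seq C) (b : B) : Prop :=
  match l with
  | [::] => base b
  | x :: l' => exists2 b', listrec_rel base step l' b' & step x l' b' b
  end.

(* [run p a b]: on input a, the program p halts with output b. *)
Fixpoint run (A B : ty) (p : prog A B) {struct p} : den A -> den B -> Prop :=
  match p in prog A B return den A -> den B -> Prop with
  | PId _ => fun a b => b = a
  | PComp _ _ _ p q => fun a c => exists2 b, run p a b & run q b c
  | PPair _ _ _ p q => fun a bc => run p a bc.1 /\ run q a bc.2
  | PFst _ _ => fun ab a => a = ab.1
  | PSnd _ _ => fun ab b => b = ab.2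
  | PTrue _ => fun _ b => b = true
  | PFalse _ => fun _ b => b = false
  | PIf _ _ t p q => fun a b =>
      (run t a true /\ run p a b) \/ (run t a false /\ run q a b)
  | PZero _ => fun _ n => n = 0%N
  | PSucc => fun n m => m = n.+1
  | PNatRec _ _ p q => fun an b =>
      natrec_rel (run p an.1) (fun i r => run q (an.1, (i, r))) an.2 b
  | PNil _ _ => fun _ l => l = [::]
  | PCons _ => fun xl l => l = xl.1 :: xl.2
  | PListRec _ _ _ p q => fun al b =>
      listrec_rel (run p al.1) (fun x l r => run q (al.1, (x, (l, r)))) al.2 b
  | PField0 _ => fun _ x => x = 0
  | PField1 _ => fun _ x => x = 1
  | PAdd => fun xy z => z = xy.1 + xy.2
  | POpp => fun x z => z = - x
  | PMul => fun xy z => z = xy.1 * xy.2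
  | PInv => fun x z => z = x^-1
  | PEq => fun xy b => b = (xy.1 == xy.2)
  | PWhile _ t p => while_rel (run t) (run p)
  end.

Lemma run_deterministic (A B : ty) (p : prog A B) (a : den A) (b b' : den B) :
  run p a b -> run p a b' -> b = b'.
Proof.
elim: p a b b' => /=; try by move=> * ; congruence.
- by move=> ? ? ? p IHp q IHq a c c' [b /IHp Hb Hc] [b' /Hb <-]; exact: IHq.
- move=> ? ? ? p IHp q IHq a [b c] [b' c'] /= [/IHp Hb /IHq Hc] [].
  by move=> /Hb -> /Hc ->.
- move=> ? ? t IHt p IHp q IHq a b b' [[ta pa]|[ta qa]] [[ta' pa']|[ta' qa']].
  + exact: IHp pa pa'.
  + by have := IHt _ _ _ ta ta'.
  + by have := IHt _ _ _ ta ta'.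
  + exact: IHq qa qa'.
- move=> ? ? p IHp q IHq [a n] /=; elim: n => [|n IH] b b' /=; first exact: IHp.
  by move=> [c /IH Hc Hb] [c' /Hc <-]; exact: IHq.
- move=> ? ? ? p IHp q IHq [a l] /=; elim: l => [|x l IH] b b' /=; first exact: IHp.
  by move=> [c /IH Hc Hb] [c' /Hc <-]; exact: IHq.
- move=> ? t IHt p IHp a b b' H; elim: H b' => {a b}.
    by move=> a ta b' H; case: H ta => // a0 ? ? t1 _ _ t0; have := IHt _ _ _ t1 t0.
  move=> a a1 a2 ta pa _ IH b' H; case: H ta pa.
    by move=> a0 t0 t1; have := IHt _ _ _ t1 t0.
  by move=> a0 c1 c2 _ pa' H _ pa; apply: IH; rewrite (IHp _ _ _ pa pa').
Qed.

(* The instances of the problem are the elements of J; [code c x] means that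
   the datum c is a presentation of the instance x.  The program must answer
   correctly whatever presentation of the instance it is given. *)
Definition algorithmically_solvable (J : Type) (A : ty) (code : den A -> J -> Prop)
    (Q : J -> Prop) : Prop :=
  exists p : prog A TBool, forall (x : J) (c : den A), code c x ->
    exists b : bool, run p c b /\ (b <-> Q x).

End Semantics.

Arguments algorithmically_solvable k {J A} code Q.

Section Presentation.
Variables (k : fieldType) (X : finType).

Definition TSym : ty := TPair TBool (TList TNat).
Definition TElem : ty := TList (TPair TField TSym).
Definition TFinSet : ty := TList TElem.

(* The word of a symbol is given by the list of its exponents along [enum X];
   the Boolean is true for the symbols of the second kind. *)
Definition sym_code (a : dsym X) : den k TSym :=
  (match a with inl _ => false | inr _ => true end,
   [seq val (dsym_word a) x | x <- enum X]).

Definition terms_code (ts : seq (k * dsym X)) : den k TElem :=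
  [seq (t.1, sym_code t.2) | t <- ts].

Definition terms_val (ts : seq (k * dsym X)) : Di k X :=
  \sum_(t <- ts) << t.1 *g t.2 >>.

(* A finite subset is presented by a list of its elements, each written as a
   linear combination of symbols; repetitions are allowed in both lists. *)
Definition presents (c : den k TFinSet) (S : {fset Di k X}) : Prop :=
  exists2 l : seq (seq (k * dsym X)),
    c = [seq terms_code ts | ts <- l] & S =i [seq terms_val ts | ts <- l].

Lemma presents_exists (S : {fset Di k X}) : exists c, presents c S.
Proof.
pose tm (f : Di k X) : seq (k * dsym X) := [seq (f@_a, a) | a <- msupp f].
have tmK f : terms_val (tm f) = f by rewrite /terms_val big_map -monalgE.
exists [seq terms_code ts | ts <- [seq tm f | f <- S]].
exists [seq tm f | f <- S] => // f.
by rewrite -map_comp (eq_map tmK) map_id.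
Qed.

Lemma sym_code_inj : injective sym_code.
Proof.
have E (u v : csg X) :
    [seq val u x | x <- enum X] = [seq val v x | x <- enum X] -> u = v.
  by move=> /eq_in_map H; apply/val_inj/eqP/cmP => x; apply: H; rewrite mem_enum.
case=> u [] v //= []; first by move=> /E ->.
by move=> /E /val_inj ->.
Qed.

End Presentation.

(* Main.v *)
Require Import Defs.
From Stdlib Require Import Classical.
From mathcomp Require Import all_boot all_order all_algebra finmap.
From mathcomp.multinomials Require Import monalg mpoly.

(** Two finite sets S and T generate the same ideal exactly when every element
    of S lies in Id(T) and every element of T lies in Id(S), so it suffices to
    decide membership in Id(S).

    _Reduction to polynomials._  In Di[X] a product of total length greater
    than 2 only depends on the word, so multiplying by a word v of length at
    least 2 is the same for both operations.  Hence Id(S) is a module over the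
    polynomial ring k[X], where a word acts by -|, and as such it is generated
    by the elements s of S and the finitely many products s |- x with a letter
    x.  To see this module inside a polynomial ring, add two variables z and w
    to X and send [u]_1 to u z and [v]_2 to v w (this is [emb]).  The word
    action becomes multiplication, up to the binomials x y t w - x y t z that
    express that long words carry only one symbol.  So f is in Id(S) if and
    only if [emb f] is in the ideal of k[X, z, w] generated by these binomials
    and by the images of all s and s |- x: this is [ideal_gensP].  For the
    direct implication, the elements f such that [emb f] and all [emb (f |- x)]
    lie in that ideal form an ideal of Di[X] ([stable_ideal]).  Conversely, a
    linear left inverse of [emb], which kills every monomial whose degree in
    z, w is not 1, maps that ideal into Id(S) ([retract_ideal]); the
    multiples by z and w, which have no counterpart in Di[X], are killed.

    _Ideal membership._  Buchberger's algorithm completes a finite list of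
    polynomials until all S-polynomials reduce to 0.  It stops by Dickson's
    lemma ([dickson], [buchberger_halts]): each added polynomial has a leading
    monomial that no earlier one divides.  When it has stopped, a polynomial is
    in the ideal if and only if it reduces to 0 ([ideal_nf0]).  The proof
    filters the ideal by the spans of the multiples a g whose leading monomial
    is at most m: two multiples with the same leading monomial m differ, up to
    scalars, by a multiple of an S-polynomial, hence by an element of the
    previous stage, so each stage adds at most one dimension to the previous
    ones and this dimension is spanned by a multiple of an element of the
    list.

    _Programs._  A function between types whose elements are represented by
    data is [computable] if some program computes it on representatives, for
    any choice of these.  Each construct of programs gives a closure property
    of computable functions, and the decision procedure is obtained by
    composing them; reduction and completion are while loops, whose
    termination is what the two previous lemmas provide. *)

Set Implicit Arguments.
Unset Strict Implicit.
Unset Printing Implicit Defensive.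

Import Order.TTheory GRing.Theory.
Import Order.DefaultSeqLexiOrder Order.DefaultTupleLexiOrder.

Local Open Scope ring_scope.

(** * Functions realized by programs *)

Section Computability.
Variable k : fieldType.

(** A relation rather than an encoding function: a polynomial is represented by
    any of the lists of terms that sum to it. *)
Record coding (J : Type) := Coding { rty : ty; rcode : den k rty -> J -> Prop }.

Definition rnat : coding nat := @Coding nat TNat (fun c x => c = x).
Definition rbool : coding bool := @Coding bool TBool (fun c x => c = x).
Definition rfield : coding k := @Coding k TField (fun c x => c = x).

Definition rpair A B (rA : coding A) (rB : coding B) : coding (A * B) :=
  @Coding _ (TPair (rty rA) (rty rB))
    (fun c x => rcode (c := rA) c.1 x.1 /\ rcode (c := rB) c.2 x.2).

Fixpoint seq_code (C A : Type) (code : C -> A -> Prop) (c : seq C) (s : seq A) :=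
  match c, s with
  | [::], [::] => True
  | d :: c', x :: s' => code d x /\ seq_code code c' s'
  | _, _ => False
  end.

Definition rseq A (rA : coding A) : coding (seq A) :=
  @Coding _ (TList (rty rA)) (seq_code (@rcode _ rA)).

Definition computable A B (rA : coding A) (rB : coding B) (f : A -> B) : Prop :=
  exists p : prog (rty rA) (rty rB), forall c x, rcode c x ->
    exists2 d, run p c d & rcode d (f x).

Lemma computable_ext A B (rA : coding A) (rB : coding B) (f g : A -> B) :
  f =1 g -> computable rA rB f -> computable rA rB g.
Proof. by move=> fg [p Hp]; exists p => c x /Hp; rewrite fg. Qed.

Lemma computable_id A (rA : coding A) : computable rA rA (fun x => x).
Proof. by exists (PId _) => c x Hc; exists c. Qed.

Lemma computable_comp A B C (rA : coding A) (rB : coding B) (rC : coding C)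
    (g : B -> C) (f : A -> B) :
  computable rB rC g -> computable rA rB f -> computable rA rC (fun x => g (f x)).
Proof.
move=> [q Hq] [p Hp]; exists (PComp p q) => c x /Hp [d pd /Hq [e qe He]].
by exists e => //=; exists d.
Qed.

Lemma computable_pair A B C (rA : coding A) (rB : coding B) (rC : coding C)
    (f : A -> B) (g : A -> C) :
  computable rA rB f -> computable rA rC g ->
  computable rA (rpair rB rC) (fun x => (f x, g x)).
Proof.
move=> [p Hp] [q Hq]; exists (PPair p q) => c x Hc.
have [d pd Hd] := Hp _ _ Hc; have [e qe He] := Hq _ _ Hc.
by exists (d, e).
Qed.

Lemma computable_fst A B C (rA : coding A) (rB : coding B) (rC : coding C)
    (f : A -> B * C) :
  computable rA (rpair rB rC) f -> computable rA rB (fun x => (f x).1).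
Proof.
apply: (@computable_comp _ _ _ _ (rpair rB rC) rB fst).
by exists (PFst _ _) => c x [Hc _]; exists c.1.
Qed.

Lemma computable_snd A B C (rA : coding A) (rB : coding B) (rC : coding C)
    (f : A -> B * C) :
  computable rA (rpair rB rC) f -> computable rA rC (fun x => (f x).2).
Proof.
apply: (@computable_comp _ _ _ _ (rpair rB rC) rC snd).
by exists (PSnd _ _) => c x [_ Hc]; exists c.2.
Qed.

Lemma computable_if A B (rA : coding A) (rB : coding B) (t : A -> bool) (f g : A -> B) :
  computable rA rbool t -> computable rA rB f -> computable rA rB g ->
  computable rA rB (fun x => if t x then f x else g x).
Proof.
move=> [r Hr] [p Hp] [q Hq]; exists (PIf r p q) => c x Hc.
have [b rb Eb] := Hr _ _ Hc.
case tx: (t x); rewrite /= tx in Eb; subst b.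
- by have [d pd Hd] := Hp _ _ Hc; exists d => //=; left.
- by have [d qd Hd] := Hq _ _ Hc; exists d => //=; right.
Qed.

Lemma computable_bool A (rA : coding A) (b : bool) : computable rA rbool (fun=> b).
Proof.
by case: b; [exists (PTrue _) => c x; exists true | exists (PFalse _) => c x; exists false].
Qed.

Lemma computable_succ A (rA : coding A) (f : A -> nat) :
  computable rA rnat f -> computable rA rnat (fun x => (f x).+1).
Proof.
by apply: (@computable_comp _ _ _ _ rnat rnat S); exists PSucc => c x /= ->; exists x.+1.
Qed.

Lemma computable_nat A (rA : coding A) (n : nat) : computable rA rnat (fun=> n).
Proof.
by elim: n => [|n IH]; [exists (PZero _) => c x; exists 0%N | exact: computable_succ].
Qed.

(** The step sees the parameter [x] as well as the counter and the accumulated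
    value, which makes loops nest without any closure conversion. *)
Lemma computable_iteri A B (rA : coding A) (rB : coding B)
    (n : A -> nat) (step : A -> nat -> B -> B) (base : A -> B) :
  computable rA rnat n -> computable rA rB base ->
  computable (rpair rA (rpair rnat rB)) rB (fun p => step p.1 p.2.1 p.2.2) ->
  computable rA rB (fun x => iteri (n x) (step x) (base x)).
Proof.
move=> [pn Hn] [p Hp] [q Hq].
exists (PComp (PPair (PId _) pn) (PNatRec p q)) => c x Hc.
have [d nd /= Ed] := Hn _ _ Hc; rewrite {}Ed in nd.
have [e Re He] : exists2 e,
    natrec_rel (run p c) (fun i r => run q (c, (i, r))) (n x) e &
    rcode e (iteri (n x) (step x) (base x)).
  elim: (n x) => [|m [e Re He]] /=; first exact: Hp Hc.
  have [|e' qe' He'] := Hq (c, (m, e)) (x, (m, iteri m (step x) (base x))) => //.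
  by exists e' => //; exists e.
by exists e => //=; exists (c, n x).
Qed.

Lemma computable_nil A B (rA : coding A) (rB : coding B) :
  computable rA (rseq rB) (fun=> [::]).
Proof. by exists (PNil _ _) => c x _; exists [::]. Qed.

Lemma computable_cons A B (rA : coding A) (rB : coding B) (f : A -> B) (s : A -> seq B) :
  computable rA rB f -> computable rA (rseq rB) s ->
  computable rA (rseq rB) (fun x => f x :: s x).
Proof.
move=> [p Hp] [q Hq]; exists (PComp (PPair p q) (PCons _)) => c x Hc.
have [d pd Hd] := Hp _ _ Hc; have [e qe He] := Hq _ _ Hc.
by exists (d :: e) => //=; exists (d, e).
Qed.

Lemma computable_foldr A B C (rA : coding A) (rB : coding B) (rC : coding C)
    (s : A -> seq C) (step : A -> C -> B -> B) (base : A -> B) :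
  computable rA (rseq rC) s -> computable rA rB base ->
  computable (rpair rA (rpair rC rB)) rB (fun p => step p.1 p.2.1 p.2.2) ->
  computable rA rB (fun x => foldr (step x) (base x) (s x)).
Proof.
move=> [ps Hs] [p Hp] [q Hq].
pose drop_tail : prog (TPair (rty rA) (TPair (rty rC) (TPair (TList (rty rC)) (rty rB))))
    (TPair (rty rA) (TPair (rty rC) (rty rB))) :=
  PPair (PFst _ _) (PComp (PSnd _ _)
    (PPair (PFst _ _) (PComp (PSnd _ _) (PSnd _ _)))).
exists (PComp (PPair (PId _) ps) (PListRec p (PComp drop_tail q))) => c x Hc.
have [l sl Hl] := Hs _ _ Hc.
pose R := listrec_rel (run p c) (fun d t r e => run (PComp drop_tail q) (c, (d, (t, r))) e).
have [e Re He] : exists2 e, R l e & rcode e (foldr (step x) (base x) (s x)).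
  elim: l (s x) Hl {sl} => [|d l IH] [|y t] //=; first by move=> _; exact: Hp Hc.
  case=> Hd /IH [e Re He].
  have [|e' qe' He'] := Hq (c, (d, e)) (x, (y, foldr (step x) (base x) t)) => //.
  exists e' => //; exists e => //.
  exists (c, (d, e)) => //; split=> //; exists (d, (l, e)) => //.
  by split=> //; exists (l, e).
by exists e => //=; exists (c, l).
Qed.

(** Uses the tail that list recursion passes to each step and that
    [computable_foldr] drops. *)
Lemma computable_behead A B (rA : coding A) (rB : coding B) (s : A -> seq B) :
  computable rA (rseq rB) s -> computable rA (rseq rB) (fun x => behead (s x)).
Proof.
apply: (@computable_comp _ _ _ _ (rseq rB) (rseq rB) behead).
exists (PComp (PPair (PId _) (PId _)) (PListRec (PNil _ _)
  (PComp (PSnd _ _) (PComp (PSnd _ _) (PFst _ _))))) => c x.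
elim: c x => [|d c IH] [|y x] //=.
  by move=> _; exists [::] => //; exists ([::], [::]).
move=> [Hd Hc]; exists c => //; exists (d :: c, d :: c) => //=.
(* The value at the tail is discarded, but the recursion must still reach it. *)
have [e Re] : exists e, listrec_rel (fun l : seq (den k (rty rB)) => l = [::])
   (fun x0 l r b => exists2 b0, b0 = (x0, (l, r)) & exists2 b1, b1 = b0.2 & b = b1.1)
   c e.
  clear; elim: c => [|d c [e He]] /=; first by exists [::].
  by exists c; exists e => //; exists (d, (c, e)) => //; exists (c, e).
by exists e => //; exists (d, (c, e)) => //; exists (c, e).
Qed.

End Computability.

(** Iterating the body the least number of times after which the test fails is what
    a while loop computes; as a total function it can be reasoned about without
    mentioning runs of programs. *)
Definition loop T (t : pred T) (b : T -> T)
    (halts : forall y, exists n, ~~ t (iter n b y)) (y : T) : T :=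
  iter (ex_minn (halts y)) b y.

Lemma loop_stop T (t : pred T) (b : T -> T) halts (y : T) :
  ~~ t (@loop T t b halts y).
Proof. by rewrite /loop; case: ex_minnP. Qed.

Lemma loop_invariant T (t : pred T) (b : T -> T) halts (y : T) (P : T -> Prop) :
  (forall z, t z -> P z -> P (b z)) -> P y -> P (@loop T t b halts y).
Proof.
move=> Pb Py; rewrite /loop; case: ex_minnP => n _ nmin.
have: forall m, (m < n)%N -> t (iter m b y).
  by move=> m; apply: contraLR => /nmin; rewrite -leqNgt.
elim: n {nmin} => //= n IH tn; apply: Pb; first exact: tn.
by apply: IH => m mn; apply: tn; rewrite ltnS ltnW.
Qed.

Section Loops.
Variable k : fieldType.

(** The program runs the loop on pairs, to carry the parameter [x] along. *)
Lemma computable_loop A B (rA : coding k A) (rB : coding k B)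
    (t : A -> pred B) (b : A -> B -> B)
    (halts : forall x y, exists n, ~~ t x (iter n (b x) y)) (y : A -> B) :
  computable (rpair rA rB) (rbool k) (fun p => t p.1 p.2) ->
  computable (rpair rA rB) rB (fun p => b p.1 p.2) ->
  computable rA rB y -> computable rA rB (fun x => loop (halts x) (y x)).
Proof.
move=> [pt Ht] [pb Hb] [py Hy].
pose step := PPair (PFst _ _) pb.
exists (PComp (PPair (PId _) py) (PComp (PWhile pt step) (PSnd _ _))) => c x Hc.
have [d dy Hd] := Hy _ _ Hc.
have [e We He] : exists2 e, run (PWhile pt step) (c, d) (c, e) &
    rcode e (loop (halts x) (y x)).
  rewrite /loop; case: ex_minnP => n tn nmin.
  have {nmin}: forall m, (m < n)%N -> t x (iter m (b x) (y x)).
    by move=> m; apply: contraLR => /nmin; rewrite -leqNgt.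
  elim: n (y x) d Hd tn {dy} => [|n IH] z d Hd tn tlt.
    exists d => //; apply: while_stop.
    have [u Hu /= Eu] := Ht (c, d) (x, z) (conj Hc Hd).
    by rewrite /= in tn; rewrite (negbTE tn) in Eu; subst u.
  have [u Hu /= Eu] := Ht (c, d) (x, z) (conj Hc Hd).
  have [d' Hd' Cd'] := Hb (c, d) (x, z) (conj Hc Hd).
  have [|m mn|e We He] := IH (b x z) d' Cd'.
  - by rewrite -iterSr.
  - by rewrite -iterSr; apply: tlt.
  exists e; last by rewrite -iterS iterSr.
  apply: (while_step (a' := (c, d'))) We => //.
  by move: (tlt 0%N isT) => /= tz; rewrite tz in Eu; subst u.
by exists e => //=; exists (c, d) => //; exists (c, e).
Qed.

(** Here [s] is a fixed list, known when the program is written: the program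
    contains one subprogram for each of its elements. *)
Lemma computable_const_map A (rA : coding k A) B I (rB : coding k B) (F : I -> A -> B) (s : seq I) :
  (forall i, computable rA rB (F i)) ->
  computable rA (rseq rB) (fun x => [seq F i x | i <- s]).
Proof.
move=> HF; elim: s => [|i s IH] /=; first exact: computable_nil.
exact: computable_cons.
Qed.

End Loops.

(** Conditionals, folds and loops are recognized by their head symbol: unification
    alone would unfold boolean connectives and list operations into them. *)
Ltac computable_step := cbn beta; first
  [ eassumption
  | eapply computable_id
  | eapply computable_fst
  | eapply computable_snd
  | eapply computable_pair
  | eapply computable_bool
  | eapply computable_nat
  | eapply computable_succ
  | lazymatch goal with |- computable _ _ (fun x => if _ then _ else _) =>
      eapply computable_if end
  | eapply computable_nil
  | eapply computable_cons
  | eapply computable_behead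
  | lazymatch goal with
    | |- computable _ _ (fun x => iteri _ _ _) => eapply computable_iteri
    | |- computable _ _ (fun x => foldr _ _ _) => eapply computable_foldr
    | |- computable _ _ (fun x => loop _ _) => eapply computable_loop
    end
  | eapply computable_const_map ].
Ltac computability := repeat computable_step.

Section Operations.
Variable k : fieldType.

(** Binary composition; it substitutes a known computable [f] for the projections
    by which the variables of an iteration step are accessed. *)
Lemma computable_app A B C D (rA : coding k A) (rB : coding k B) (rC : coding k C) (rD : coding k D)
    (f : B -> C -> D) (g : A -> B) (h : A -> C) :
  computable (rpair rB rC) rD (fun p => f p.1 p.2) ->
  computable rA rB g -> computable rA rC h -> computable rA rD (fun x => f (g x) (h x)).
Proof.
move=> Hf Hg Hh; apply: (computable_comp (f := fun x => (g x, h x)) Hf).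
exact: computable_pair.
Qed.

Lemma computable_map A B C (rA : coding k A) (rB : coding k B) (rC : coding k C)
    (f : A -> C -> B) (s : A -> seq C) :
  computable rA (rseq rC) s -> computable (rpair rA rC) rB (fun p => f p.1 p.2) ->
  computable rA (rseq rB) (fun x => [seq f x y | y <- s x]).
Proof.
move=> Hs Hf.
apply: (@computable_ext _ _ _ _ _ (fun x => foldr (fun y r => f x y :: r) [::] (s x))).
  by move=> x; elim: (s x) => //= y t ->.
computability; apply: (computable_app (f := f)) Hf _ _; computability.
Qed.

Lemma computable_cat A B (rA : coding k A) (rB : coding k B) (s t : A -> seq B) :
  computable rA (rseq rB) s -> computable rA (rseq rB) t ->
  computable rA (rseq rB) (fun x => s x ++ t x).
Proof.
move=> Hs Ht.
apply: (@computable_ext _ _ _ _ _ (fun x => foldr cons (t x) (s x))).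
  by move=> x; elim: (s x) => //= y u ->.
by computability.
Qed.

Lemma computable_and A (rA : coding k A) (a b : A -> bool) :
  computable rA (rbool k) a -> computable rA (rbool k) b ->
  computable rA (rbool k) (fun x => a x && b x).
Proof. by move=> Ha Hb; rewrite /andb; computability. Qed.

Lemma computable_neg A (rA : coding k A) (a : A -> bool) :
  computable rA (rbool k) a -> computable rA (rbool k) (fun x => ~~ a x).
Proof. by move=> Ha; rewrite /negb; computability. Qed.

Lemma computable_has A C (rA : coding k A) (rC : coding k C) (a : A -> C -> bool) (s : A -> seq C) :
  computable rA (rseq rC) s -> computable (rpair rA rC) (rbool k) (fun p => a p.1 p.2) ->
  computable rA (rbool k) (fun x => has (a x) (s x)).
Proof.
move=> Hs Ha.
apply: (@computable_ext _ _ _ _ _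
  (fun x => foldr (fun y r => if a x y then true else r) false (s x))).
  by move=> x; elim: (s x) => //= y t ->; case: (a x y).
by computability; apply: (computable_app (f := a)) Ha _ _; computability.
Qed.

Lemma computable_all A C (rA : coding k A) (rC : coding k C) (a : A -> C -> bool) (s : A -> seq C) :
  computable rA (rseq rC) s -> computable (rpair rA rC) (rbool k) (fun p => a p.1 p.2) ->
  computable rA (rbool k) (fun x => all (a x) (s x)).
Proof.
move=> Hs Ha; apply: (@computable_ext _ _ _ _ _ (fun x => ~~ has (fun y => ~~ a x y) (s x))).
  by move=> x; rewrite has_predC negbK.
by apply: computable_neg; apply: computable_has Hs _; apply: computable_neg.
Qed.

Lemma computable_flatten A B (rA : coding k A) (rB : coding k B)
    (s : A -> seq (seq B)) :
  computable rA (rseq (rseq rB)) s ->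
  computable rA (rseq rB) (fun x => flatten (s x)).
Proof.
move=> Hs; rewrite /flatten; computability; apply: computable_cat; computability.
Qed.

Lemma computable_pred A (rA : coding k A) (n : A -> nat) :
  computable rA (rnat k) n -> computable rA (rnat k) (fun x => (n x).-1).
Proof.
move=> Hn.
apply: (@computable_ext _ _ _ _ _ (fun x => iteri (n x) (fun i _ => i) 0%N)).
  by move=> x; case: (n x).
by computability.
Qed.

Lemma computable_add A (rA : coding k A) (m n : A -> nat) :
  computable rA (rnat k) m -> computable rA (rnat k) n ->
  computable rA (rnat k) (fun x => m x + n x)%N.
Proof.
move=> Hm Hn.
apply: (@computable_ext _ _ _ _ _ (fun x => iteri (m x) (fun _ => S) (n x))).
  by move=> x; elim: (m x) => //= i ->.
by computability.
Qed.

Lemma computable_sub A (rA : coding k A) (m n : A -> nat) :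
  computable rA (rnat k) m -> computable rA (rnat k) n ->
  computable rA (rnat k) (fun x => m x - n x)%N.
Proof.
move=> Hm Hn.
apply: (@computable_ext _ _ _ _ _ (fun x => iteri (n x) (fun _ => predn) (m x))).
  by move=> x; elim: (n x) => [|i /= ->]; rewrite ?subn0 ?subnS.
by computability; apply: computable_pred; computability.
Qed.

Lemma computable_leq A (rA : coding k A) (m n : A -> nat) :
  computable rA (rnat k) m -> computable rA (rnat k) n ->
  computable rA (rbool k) (fun x => m x <= n x)%N.
Proof.
move=> Hm Hn.
apply: (@computable_ext _ _ _ _ _
  (fun x => iteri (m x - n x) (fun _ _ => false) true)).
  by move=> x; rewrite -subn_eq0; case: (m x - n x)%N.
by computability; apply: computable_sub.
Qed.

Lemma computable_eqn A (rA : coding k A) (m n : A -> nat) :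
  computable rA (rnat k) m -> computable rA (rnat k) n ->
  computable rA (rbool k) (fun x => m x == n x).
Proof.
move=> Hm Hn.
apply: (@computable_ext _ _ _ _ _ (fun x => (m x <= n x) && (n x <= m x))%N).
  by move=> x; rewrite eqn_leq.
by apply: computable_and; apply: computable_leq.
Qed.

Lemma computable_maxn A (rA : coding k A) (m n : A -> nat) :
  computable rA (rnat k) m -> computable rA (rnat k) n ->
  computable rA (rnat k) (fun x => maxn (m x) (n x)).
Proof.
move=> Hm Hn; apply: (@computable_ext _ _ _ _ _ (fun x => m x + (n x - m x))%N).
  by move=> x; rewrite maxnE.
by apply: computable_add => //; apply: computable_sub.
Qed.

Lemma computable_sumn A (rA : coding k A) (s : A -> seq nat) :
  computable rA (rseq (rnat k)) s -> computable rA (rnat k) (fun x => sumn (s x)).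
Proof.
by move=> Hs; rewrite /sumn; computability; apply: computable_add; computability.
Qed.

Lemma computable_nth A (rA : coding k A) i (s : A -> seq nat) :
  computable rA (rseq (rnat k)) s -> computable rA (rnat k) (fun x => nth 0%N (s x) i).
Proof.
elim: i s => [|i IH] s Hs.
  apply: (@computable_ext _ _ _ _ _ (fun x => foldr (fun y _ => y) 0%N (s x))).
    by move=> x; case: (s x).
  by computability.
apply: (@computable_ext _ _ _ _ _ (fun x => nth 0%N (behead (s x)) i)).
  by move=> x; rewrite nth_behead.
by apply: IH; computability.
Qed.

Lemma computable_lexi A (rA : coding k A) I (F G : I -> A -> nat) (s : seq I) :
  (forall i, computable rA (rnat k) (F i)) ->
  (forall i, computable rA (rnat k) (G i)) ->
  computable rA (rbool k)
    (fun x => ([seq F i x | i <- s] <= [seq G i x | i <- s])%O).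
Proof.
move=> HF HG; elim: s => [|i s IH] /=; first exact: computable_bool.
apply: (@computable_ext _ _ _ _ _ (fun x => (F i x <= G i x)%N &&
   if (G i x <= F i x)%N then ([seq F j x | j <- s] <= [seq G j x | j <- s])%O else true)).
  by move=> x; rewrite lexi_cons !leEnat; case: (G i x <= F i x)%N.
by apply: computable_and; computability; apply: computable_leq.
Qed.

Lemma computable_fadd A (rA : coding k A) (a b : A -> k) :
  computable rA (rfield k) a -> computable rA (rfield k) b ->
  computable rA (rfield k) (fun x => a x + b x).
Proof.
apply: (computable_app (f := fun c d : k => c + d)).
by exists (PAdd) => -[c1 c2] [x1 x2] /= [-> ->]; exists (x1 + x2).
Qed.

Lemma computable_fmul A (rA : coding k A) (a b : A -> k) :
  computable rA (rfield k) a -> computable rA (rfield k) b ->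
  computable rA (rfield k) (fun x => a x * b x).
Proof.
apply: (computable_app (f := fun c d : k => c * d)).
by exists (PMul) => -[c1 c2] [x1 x2] /= [-> ->]; exists (x1 * x2).
Qed.

Lemma computable_feq A (rA : coding k A) (a b : A -> k) :
  computable rA (rfield k) a -> computable rA (rfield k) b ->
  computable rA (rbool k) (fun x => a x == b x).
Proof.
apply: (computable_app (f := fun c d : k => c == d)).
by exists (PEq) => -[c1 c2] [x1 x2] /= [-> ->]; exists (x1 == x2).
Qed.

Lemma computable_fopp A (rA : coding k A) (a : A -> k) : computable rA (rfield k) a ->
  computable rA (rfield k) (fun x => - a x).
Proof.
by apply: (@computable_comp _ _ _ _ _ (rfield k) _ (@GRing.opp k));
   exists POpp => c x /= ->; exists (- x).
Qed.

Lemma computable_f0 A (rA : coding k A) : computable rA (rfield k) (fun=> 0).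
Proof. by exists (PField0 _) => c x; exists 0. Qed.

Lemma computable_f1 A (rA : coding k A) : computable rA (rfield k) (fun=> 1).
Proof. by exists (PField1 _) => c x; exists 1. Qed.

End Operations.

(** * Dickson's lemma *)

Section Dickson.

Definition infinite (P : nat -> Prop) := forall N, exists2 i, (N <= i)%N & P i.

(** Keep the indices at which [u] takes its least value among the later indices of
    [P].  There are infinitely many of them: from any index, moving on to smaller
    and smaller values must stop. *)
Lemma infinite_nondecreasing (P : nat -> Prop) (u : nat -> nat) : infinite P ->
  infinite (fun i => P i /\ forall j, P j -> (i <= j)%N -> (u i <= u j)%N).
Proof.
move=> infP N; have [i Ni Pi] := infP N.
have [v] := ubnP (u i); elim: v i Ni Pi => // v IH i Ni Pi; rewrite ltnS => uv.
have [|min] := classic (exists2 j, P j & (i <= j)%N && (u j < u i)%N).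
  case=> j Pj /andP[ij uji]; apply: IH Pj _; first exact: leq_trans ij.
  exact: leq_trans uv.
exists i => //; split=> // j Pj ij; rewrite leqNgt; apply/negP => uji.
by apply: min; exists j; rewrite ?ij.
Qed.

(** Thin out the infinite set of indices once for each variable, until every
    exponent is nondecreasing along the remaining indices. *)
Lemma dickson n (u : nat -> 'X_{1..n}) :
  exists i j, (i < j)%N /\ (u i <= u j)%MM.
Proof.
have [Q infQ Qmono] : exists2 Q, infinite Q & forall c : 'I_n, c \in enum 'I_n ->
    forall i j, Q i -> Q j -> (i <= j)%N -> (u i c <= u j c)%N.
  elim: (enum 'I_n) => [|c s [Q infQ Qmono]].
    by exists (fun=> True) => // N; exists N.
  have infQ' := infinite_nondecreasing (fun i => u i c) infQ.
  eexists; first exact: infQ'.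
  move=> d; rewrite inE => /predU1P[-> | ds] i j [Qi mi] [Qj _] ij.
    exact: mi Qj ij.
  exact: Qmono ds _ _ Qi Qj ij.
have [i _ Qi] := infQ 0%N; have [j ij Qj] := infQ i.+1.
exists i, j; split=> //; apply/mnm_lepP => c.
by apply: Qmono (mem_enum _ c) _ _ Qi Qj (ltnW ij).
Qed.

End Dickson.

(** * Linear spans *)

Section Span.
Variables (k : fieldType) (V : lmodType k).
Implicit Types (A B : V -> Prop) (f g : V).

Inductive lin_span A : V -> Prop :=
| lin_span0 : lin_span A 0
| lin_span_cons c x f of A x & lin_span A f : lin_span A (c *: x + f).

Lemma lin_span_in A f : A f -> lin_span A f.
Proof.
move=> Af; rewrite -[f]addr0 -[f]scale1r.
by apply: lin_span_cons => //; apply: lin_span0.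
Qed.

Lemma lin_spanD A f g : lin_span A f -> lin_span A g -> lin_span A (f + g).
Proof.
move=> Af Ag; elim: Af => [|c x f' Ax _ IH]; first by rewrite add0r.
by rewrite -addrA; apply: lin_span_cons.
Qed.

Lemma lin_spanZ A c f : lin_span A f -> lin_span A (c *: f).
Proof.
elim=> [|d x g Ax _ IH]; first by rewrite scaler0; apply: lin_span0.
by rewrite scalerDr scalerA; apply: lin_span_cons.
Qed.

Lemma lin_spanB A f g : lin_span A f -> lin_span A g -> lin_span A (f - g).
Proof. by move=> Af Ag; rewrite -scaleN1r; apply: lin_spanD => //; apply: lin_spanZ. Qed.

Lemma lin_span_sum A I (r : seq I) (F : I -> V) :
  (forall i, lin_span A (F i)) -> lin_span A (\sum_(i <- r) F i).
Proof.
move=> AF; elim: r => [|i r IH]; first by rewrite big_nil; apply: lin_span0.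
by rewrite big_cons; apply: lin_spanD.
Qed.

End Span.

Lemma linear_map0 (k : fieldType) (V W : lmodType k) (L : V -> W) :
  (forall c x y, L (c *: x + y) = c *: L x + L y) -> L 0 = 0.
Proof.
move=> linL; have := linL 1 0 0; rewrite !scale1r addr0 => /eqP.
by rewrite -subr_eq0 opprD addNKr oppr_eq0 => /eqP.
Qed.

Lemma lin_span_linear (k : fieldType) (V W : lmodType k) (A : V -> Prop) (B : W -> Prop)
    (L : V -> W) :
  (forall c x y, L (c *: x + y) = c *: L x + L y) ->
  (forall x, A x -> lin_span B (L x)) -> forall f, lin_span A f -> lin_span B (L f).
Proof.
move=> linL AB f; elim=> [|c x g Ax _ IH]; first by rewrite linear_map0 //; apply: lin_span0.
by rewrite linL; apply: lin_spanD => //; apply: lin_spanZ; apply: AB.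
Qed.

(** * Groebner bases and ideal membership *)

Section Groebner.
Variables (n : nat) (k : fieldType).
Local Notation R := (mpoly n k).
Local Notation mon := 'X_{1..n}.
Implicit Types (f g h : R) (m a b : mon) (G : seq R).

Definition shift G f := exists a g, g \in G /\ f = 'X_[a] * g.

(** Multiples by monomials suffice to span the ideal, so that no product of
    arbitrary polynomials ever has to be considered. *)
Definition ideal G : R -> Prop := lin_span (shift G).

Lemma ideal_mulX G a f : ideal G f -> ideal G ('X_[a] * f).
Proof.
apply: lin_span_linear; first by move=> c x y; rewrite mulrDr -scalerAr.
move=> _ [b [g [gG ->]]]; apply: lin_span_in; exists (a + b)%MM, g; split=> //.
by rewrite mpolyXD mulrA.
Qed.

Lemma ideal_mem G g : g \in G -> ideal G g.
Proof. by move=> gG; apply: lin_span_in; exists 0%MM, g; rewrite mpolyX0 mul1r. Qed.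

Lemma ideal_mulX_mem G a g : g \in G -> ideal G ('X_[a] * g).
Proof. by move=> gG; apply: ideal_mulX; apply: ideal_mem. Qed.

(** Unlike [mlead f < m], this holds for 0 whatever [m] is, so it is a linear condition. *)
Definition below m f := {in msupp f, forall m', (m' < m)%O}.

Lemma belowD m f g : below m f -> below m g -> below m (f + g).
Proof. by move=> bf bg m' /msuppD_le; rewrite mem_cat => /orP[/bf | /bg]. Qed.

Lemma belowZ m c f : below m f -> below m (c *: f).
Proof. by move=> bf m' /msuppZ_le /bf. Qed.

Lemma below0 m : below m 0.
Proof. by move=> m'; rewrite msupp0. Qed.

Lemma mcoeff_below m f : below m f -> f@_m = 0.
Proof. by move=> bf; apply: memN_msupp_eq0; apply/negP => /bf; rewrite ltxx. Qed.

Lemma mlead_below m f : f != 0 -> below m f -> (mlead f < m)%O.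
Proof. by move=> f0; apply; apply: mlead_supp. Qed.

Lemma msupp_mulX a f m : m \in msupp ('X_[a] * f) ->
  exists2 m', m' \in msupp f & m = (a + m')%MM.
Proof. by rewrite mulrC (perm_mem (msuppMX f a)) => /mapP[m' m'f ->]; exists m'. Qed.

Lemma mcoeff_mulX a f m : ('X_[a] * f)@_(a + m) = f@_m.
Proof. by rewrite mulrC mcoeffMX. Qed.

Lemma mcoeff_mulX_mlead g m : (mlead g <= m)%MM ->
  ('X_[m - mlead g] * g)@_m = mleadc g.
Proof. by move=> gm; rewrite -{1}(submK gm) mcoeff_mulX. Qed.

Lemma le_mulX a g m : m \in msupp ('X_[a] * g) -> (m <= (a + mlead g)%MM)%O.
Proof. by case/msupp_mulX => m' m'g ->; rewrite lemc_add2r msupp_le_mlead. Qed.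

Lemma below_cancel m f g :
  {in msupp f, forall m', (m' <= m)%O} -> {in msupp g, forall m', (m' <= m)%O} ->
  f@_m = g@_m -> below m (f - g).
Proof.
move=> lf lg fg m' m'fg; rewrite lt_neqAle; apply/andP; split.
  apply: contraTneq m'fg => ->.
  by rewrite mcoeff_msupp mcoeffB fg subrr eqxx.
by move/msuppB_le: m'fg; rewrite mem_cat => /orP[/lf | /lg].
Qed.

Definition divides g f := (g != 0) && (mlead g <= mlead f)%MM.

Definition reducible G f := (f != 0) && has (fun g => divides g f) G.

(** Cross-multiplying by the leading coefficients cancels the leading terms without
    any division. *)
Definition lred g f := mleadc g *: f - mleadc f *: ('X_[mlead f - mlead g] * g).

(** One step of reduction of the leading term only: membership is decided by whether
    the result vanishes, so the lower terms need not be reduced. *)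
Definition red1 G f := foldr (fun g r => if divides g f then lred g f else r) f G.

Lemma lred_below g f : divides g f -> below (mlead f) (lred g f).
Proof.
case/andP=> _ gf; apply: below_cancel.
- by move=> m' /msuppZ_le /msupp_le_mlead.
- by move=> m' /msuppZ_le /le_mulX; rewrite submK.
by rewrite !mcoeffZ mcoeff_mulX_mlead // mulrC.
Qed.

Lemma red1P G f : reducible G f ->
  exists g, [/\ g \in G, divides g f & red1 G f = lred g f].
Proof.
case/andP=> _; elim: G => //= g G IH; case gf: (divides g f).
  by exists g; rewrite inE eqxx.
by case/IH=> h [hG hf E]; exists h; rewrite inE hG orbT.
Qed.

(** Each step lowers the leading monomial, and monomials are well-ordered. *)
Lemma red1_halts G f : exists i, ~~ reducible G (iter i (red1 G) f).
Proof.
move: {2}(mlead f) (erefl (mlead f)) => m; elim/(@ltmwf n): m f => m IH f fm.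
case rf: (reducible G f); last by exists 0%N; rewrite /= rf.
have [g [_ gf E]] := red1P rf; have bf := lred_below gf; rewrite -E fm in bf.
have [r0|r0] := eqVneq (red1 G f) 0.
  by exists 1%N; rewrite /reducible /= r0 eqxx.
have [i Hi] := IH _ (mlead_below r0 bf) _ erefl.
by exists i.+1; rewrite iterSr.
Qed.

Definition nf G f : R := loop (red1_halts G) f.

Lemma nf_irreducible G f : ~~ reducible G (nf G f).
Proof. exact: loop_stop. Qed.

Lemma mleadc_neq0 f : f != 0 -> mleadc f != 0.
Proof. by rewrite mleadc_eq0. Qed.

Lemma lredK g f : g != 0 ->
  f = (mleadc g)^-1 *: (lred g f + mleadc f *: ('X_[mlead f - mlead g] * g)).
Proof. by move=> g0; rewrite subrK scalerA mulVf ?scale1r // mleadc_neq0. Qed.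

Lemma ideal_nf G f : ideal G (nf G f) <-> ideal G f.
Proof.
apply: (@loop_invariant _ _ _ (red1_halts G) f
  (fun f' => ideal G f' <-> ideal G f)) => // f' rf <-.
have [g [gG gf ->]] := red1P rf.
split=> If.
  rewrite (lredK f' (proj1 (andP gf))); apply: lin_spanZ; apply: lin_spanD If _.
  by apply: lin_spanZ; apply: ideal_mulX_mem.
by apply: lin_spanB; apply: lin_spanZ => //; apply: ideal_mulX_mem.
Qed.

(** With [P] an upper bound, these multiples span the stages of the filtration of the
    ideal; [g != 0] ensures that [a + mlead g] is the leading monomial. *)
Definition bshift (P : pred mon) G f :=
  exists a g, [/\ g \in G, g != 0, P (a + mlead g)%MM & f = 'X_[a] * g].

(** Every subtracted multiple has the leading monomial of the polynomial it reduces,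
    and these stay below [m] throughout the reduction. *)
Lemma nf0_lt_span G m f : below m f -> nf G f = 0 ->
  lin_span (bshift (fun m' => m' < m)%O G) f.
Proof.
move=> bf nf0; set W := lin_span _.
pose inv z := below m z /\ (W z -> W f).
have [] : inv (nf G f).
  apply: (@loop_invariant _ _ _ (red1_halts G) f inv) => //.
  move=> z rz [bz zf]; have [g [gG gz ->]] := red1P rz.
  have lz := mlead_below (proj1 (andP rz)) bz.
  have [g0 dgz] := andP gz.
  split.
    by move=> m' /(lred_below gz) m'z; apply: lt_trans lz.
  move=> Wr; apply: zf; rewrite (lredK z g0); apply: lin_spanZ; apply: lin_spanD Wr _.
  apply: lin_spanZ; apply: lin_span_in; exists (mlead z - mlead g)%MM, g; split=> //.
  by rewrite submK.
by rewrite nf0 => _; apply; apply: lin_span0.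
Qed.

Definition spoly g h :=
  let l := mlcm (mlead g) (mlead h) in
  mleadc h *: ('X_[l - mlead g] * g) - mleadc g *: ('X_[l - mlead h] * h).

Lemma spoly_below g h : below (mlcm (mlead g) (mlead h)) (spoly g h).
Proof.
have gl := lem_mlcml (mlead g) (mlead h); have hl := lem_mlcmr (mlead g) (mlead h).
apply: below_cancel.
- by move=> m' /msuppZ_le /le_mulX; rewrite submK.
- by move=> m' /msuppZ_le /le_mulX; rewrite submK.
by rewrite !mcoeffZ !mcoeff_mulX_mlead // mulrC.
Qed.

Section Criterion.
Variable G : seq R.
Hypothesis Gspoly : forall g h, g \in G -> h \in G -> nf G (spoly g h) = 0.

Local Notation lt_span m := (lin_span (bshift (fun m' => m' < m)%O G)).
Local Notation le_span m := (lin_span (bshift (fun m' => m' <= m)%O G)).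

Lemma lt_span_below m f : lt_span m f -> below m f.
Proof.
elim=> [|c x g [a [h [_ _ ahm ->]]] _ bg]; first exact: below0.
apply: belowD bg; apply: belowZ => m' /le_mulX m'ah; exact: le_lt_trans ahm.
Qed.

(** Multiples with equal leading monomials cancel through an S-polynomial: the left-hand
    side is the multiple of [spoly g h] by the quotient of the common leading
    monomial by the least common multiple. *)
Lemma overlap_lt_span a b g h : g \in G -> h \in G ->
  (a + mlead g = b + mlead h)%MM ->
  lt_span (a + mlead g)%MM (mleadc h *: ('X_[a] * g) - mleadc g *: ('X_[b] * h)).
Proof.
move=> gG hG Em; set m := (a + mlead g)%MM in Em *.
set l := mlcm (mlead g) (mlead h).
have gl : (mlead g <= l)%MM := lem_mlcml _ _.
have hl : (mlead h <= l)%MM := lem_mlcmr _ _.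
have lm : (l <= m)%MM by rewrite lem_mlcm {2}Em !lem_addl.
have Ea : a = (m - l + (l - mlead g))%MM by rewrite addmBA // submK // addmK.
have Eb : b = (m - l + (l - mlead h))%MM by rewrite addmBA // submK // Em addmK.
have -> : mleadc h *: ('X_[a] * g) - mleadc g *: ('X_[b] * h) =
    'X_[m - l] * spoly g h.
  by rewrite {1}Ea {1}Eb !mpolyXD /spoly -/l mulrBr -!scalerAr !mulrA.
have := nf0_lt_span (@spoly_below g h) (Gspoly gG hG).
apply: lin_span_linear => [c x y|_ [c [p [pG p0 cpl ->]]]].
  by rewrite mulrDr -scalerAr.
apply: lin_span_in; exists (m - l + c)%MM, p; split=> //; last by rewrite mpolyXD mulrA.
by rewrite -addmA -(submK lm) addmK ltmc_add2r.
Qed.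

(** The stage of [m] exceeds the stage strictly below [m] by one dimension at most: all
    multiples with leading monomial [m] are proportional modulo the latter. *)
Lemma le_spanP m f : le_span m f ->
  lt_span m f \/ exists c a g w, [/\ g \in G, g != 0, (a + mlead g)%MM = m,
    lt_span m w & f = c *: ('X_[a] * g) + w].
Proof.
elim=> [|c x f' [a [g [gG g0 agm ->]]] _ IH]; first by left; apply: lin_span0.
move: agm; rewrite le_eqVlt => /predU1P[agm|agm]; last first.
  have lt_ag : lt_span m (c *: ('X_[a] * g)).
    by apply: lin_spanZ; apply: lin_span_in; exists a, g.
  case: IH => [ltf|[d [b [h [w [hG h0 bhm ltw ->]]]]]].
    by left; apply: lin_spanD.
  right; exists d, b, h, (c *: ('X_[a] * g) + w); split=> //; first exact: lin_spanD.
  by rewrite addrCA.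
right; case: IH => [ltf|[d [b [h [w [hG h0 bhm ltw ->]]]]]].
  by exists c, a, g, f'.
(* The multiple of h is traded for a multiple of g: the scalars are those that
   make the combination of overlap_lt_span cancel it. *)
exists (c + d * mleadc h / mleadc g), a, g,
  (- (d / mleadc g) *: (mleadc h *: ('X_[a] * g) - mleadc g *: ('X_[b] * h)) + w).
split=> //.
  apply: lin_spanD ltw; apply: lin_spanZ; rewrite -agm; apply: overlap_lt_span => //.
  by rewrite bhm.
rewrite scalerDl -!addrA; congr (_ + _); rewrite addrA; congr (_ + _).
rewrite scaleNr scalerBr !scalerA opprB (mulrAC d) divfK ?mleadc_neq0 //.
by rewrite addrC subrK.
Qed.

(** An element is a combination of finitely many multiples: take the largest of their
    leading monomials. *)
Lemma lt_spanP m f : lt_span m f -> f = 0 \/ exists2 m', (m' < m)%O & le_span m' f.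
Proof.
have mono m1 m2 g : (m1 <= m2)%O -> le_span m1 g -> le_span m2 g.
  move=> m12; apply: (@lin_span_linear _ _ _ _ _ id) => // x [a [p [pG p0 apm ->]]].
  by apply: lin_span_in; exists a, p; split=> //; apply: le_trans m12.
elim=> [|c x f' [a [g [gG g0 agm ->]]] _ IH]; first by left.
have le_ag m1 : ((a + mlead g)%MM <= m1)%O -> le_span m1 (c *: ('X_[a] * g)).
  by move=> le1; apply: lin_spanZ; apply: lin_span_in; exists a, g.
right; case: IH => [->|[m' m'm lef]].
  by exists (a + mlead g)%MM => //; rewrite addr0; apply: le_ag.
exists (Order.max (a + mlead g)%MM m'); first by rewrite gt_max agm.
apply: lin_spanD; first by apply: le_ag; rewrite le_max lexx.
by apply: mono lef; rewrite le_max lexx orbT.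
Qed.

(** Descend through the filtration to the first stage that contains [f]; there the
    component along the multiple of [g] is not zero, and since the rest lies strictly
    below, it provides the leading term of [f]. *)
Lemma le_span_reducible m f : le_span m f -> f != 0 -> reducible G f.
Proof.
elim/(@ltmwf n): m f => m IH f lef f0.
case: (le_spanP lef) => [|[c [a [g [w [gG g0 agm ltw Ef]]]]]].
  by case/lt_spanP=> [f00|[m' m'm lef']]; [rewrite f00 eqxx in f0 | apply: (IH m')].
have [c0|c0] := eqVneq c 0.
  rewrite c0 scale0r add0r in Ef; rewrite -{}Ef in ltw.
  by case/lt_spanP: ltw => [f00|[m' m'm lef']]; [rewrite f00 eqxx in f0 | apply: (IH m')].
rewrite /reducible f0; apply/hasP; exists g => //; rewrite /divides g0 /=.
suff -> : mlead f = m by rewrite -agm lem_addl.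
apply: le_anti; apply/andP; split; last first.
  apply: msupp_le_mlead; rewrite mcoeff_msupp Ef mcoeffD mcoeffZ.
  rewrite (mcoeff_below (lt_span_below ltw)) addr0 -agm mcoeff_mulX.
  by rewrite mulf_neq0 ?mleadc_neq0.
have := mlead_supp f0; rewrite {2}Ef => /msuppD_le; rewrite mem_cat => /orP[].
  by move=> /msuppZ_le /le_mulX; rewrite agm.
by move=> /(lt_span_below ltw) /ltW.
Qed.

Lemma ideal_reducible f : ideal G f -> f != 0 -> reducible G f.
Proof.
suff le_ideal : ideal G f -> exists m, le_span m f.
  by case/le_ideal => m; apply: le_span_reducible.
elim=> [|c x f' [a [g [gG ->]]] _ [m lef]]; first by exists 0%MM; apply: lin_span0.
have [->|g0] := eqVneq g 0; first by exists m; rewrite mulr0 scaler0 add0r.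
exists (Order.max (a + mlead g)%MM m); apply: lin_span_cons.
  by exists a, g; split=> //; rewrite le_max lexx.
apply: (@lin_span_linear _ _ _ _ _ id) lef => // x' [b [p [pG p0 bpm ->]]].
by apply: lin_span_in; exists b, p; split=> //; rewrite le_max bpm orbT.
Qed.

Lemma ideal_nf0 f : ideal G f <-> nf G f = 0.
Proof.
split=> [/ideal_nf If|nf0].
  apply/eqP; apply/negPn/negP => nf0; have := nf_irreducible G f.
  by rewrite ideal_reducible.
by apply/ideal_nf; rewrite nf0; apply: lin_span0.
Qed.

End Criterion.

Definition spolys G := flatten [seq [seq nf G (spoly g h) | h <- G] | g <- G].

(** By the criterion above, this vanishes exactly when [G] is a Groebner basis. *)
Definition new_generator G : R := foldr (fun r s => if r != 0 then r else s) 0 (spolys G).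

Lemma new_generator_in G : new_generator G != 0 -> new_generator G \in spolys G.
Proof.
rewrite /new_generator; elim: (spolys G) => [|r s IH] /=; first by rewrite eqxx.
by rewrite inE; case: ifP; rewrite ?eqxx // => _ /IH ->; rewrite orbT.
Qed.

Lemma new_generator_eq0 G : new_generator G = 0 -> {in spolys G, forall r, r = 0}.
Proof.
rewrite /new_generator; elim: (spolys G) => [|r s IH] //= E r'.
rewrite inE; have [r0|r0] := eqVneq r 0; last by rewrite r0 in E; move: r0; rewrite E eqxx.
by case/predU1P => [->//|]; apply: IH; rewrite r0 eqxx in E.
Qed.

(** The added remainders are irreducible by everything added before, so their leading
    monomials form a sequence in which none divides a later one. *)
Lemma buchberger_halts G :
  exists i, ~~ (new_generator (iter i (fun G' => new_generator G' :: G') G) != 0).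
Proof.
apply: NNPP => nohalt; pose S i := iter i (fun G' => new_generator G' :: G') G.
have nz i : new_generator (S i) != 0.
  by apply: contraT => z; case: nohalt; exists i.
have [i [j [ij dij]]] := dickson (fun i => mlead (new_generator (S i))).
have irr : ~~ reducible (S j) (new_generator (S j)).
  by have /flatten_mapP[g gG /mapP[h hG ->]] := new_generator_in (nz j); apply: nf_irreducible.
case/negP: irr; rewrite /reducible nz; apply/hasP; exists (new_generator (S i)).
  elim: j ij {dij} => // j IH; rewrite ltnS leq_eqVlt => /predU1P[->|/IH] /=.
    by rewrite inE eqxx.
  by rewrite inE orbC => ->.
by rewrite /divides nz.
Qed.

Definition buchberger G : seq R :=
  @loop _ (fun G' => new_generator G' != 0) (fun G' => new_generator G' :: G')
    buchberger_halts G.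

Lemma buchberger_spoly G g h : g \in buchberger G -> h \in buchberger G ->
  nf (buchberger G) (spoly g h) = 0.
Proof.
move=> gG hG; have := @loop_stop _ (fun G' => new_generator G' != 0) _ buchberger_halts G.
rewrite -/(buchberger G) negbK => /eqP /new_generator_eq0; apply.
by apply/flatten_mapP; exists g => //; apply/mapP; exists h.
Qed.

Lemma ideal_subset G G' : (forall g, g \in G -> ideal G' g) ->
  forall f, ideal G f -> ideal G' f.
Proof.
move=> GG'; apply: (@lin_span_linear _ _ _ _ _ id) => // _ [a [g [gG ->]]].
by apply: ideal_mulX; apply: GG'.
Qed.

Lemma ideal_spoly G g h : g \in G -> h \in G -> ideal G (spoly g h).
Proof. by move=> gG hG; apply: lin_spanB; apply: lin_spanZ; apply: ideal_mulX_mem. Qed.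

Lemma ideal_buchberger G f : ideal (buchberger G) f <-> ideal G f.
Proof.
apply: (@loop_invariant _ (fun G' => new_generator G' != 0) _ buchberger_halts G
  (fun G' => ideal G' f <-> ideal G f)) => // G' nz <-.
split; apply: ideal_subset => g; last by move=> gG; apply: ideal_mem; rewrite inE gG orbT.
rewrite inE => /predU1P[->|]; last exact: ideal_mem.
have /flatten_mapP[p pG /mapP[q qG ->]] := new_generator_in nz.
by apply/ideal_nf; apply: ideal_spoly.
Qed.

Definition in_ideal G f : bool := nf (buchberger G) f == 0.

Lemma in_idealP G f : reflect (ideal G f) (in_ideal G f).
Proof.
apply: (iffP eqP) => [/(ideal_nf0 (@buchberger_spoly G)) /ideal_buchberger //|If].
by apply/(ideal_nf0 (@buchberger_spoly G))/ideal_buchberger.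
Qed.

End Groebner.

(** * Computability of polynomial operations *)

Section Polynomials.
Variables (k : fieldType) (n : nat).
Local Notation R := (mpoly n k).
Local Notation mon := 'X_{1..n}.

Definition rmon : coding k mon :=
  @Coding k mon (TList TNat) (fun c m => c = [seq m i | i <- enum 'I_n]).

Definition rterms : coding k (seq (k * mon)) := rseq (rpair (rfield k) rmon).

Definition poly_of_terms (s : seq (k * mon)) : R := \sum_(t <- s) t.1 *: 'X_[t.2].

(** Terms may be repeated and coefficients may be 0: sums and multiples by terms are
    then immediate, and only the coefficients have to be collected. *)
Definition rpoly : coding k R :=
  @Coding k R (rty rterms)
    (fun c f => exists2 s, rcode (c := rterms) c s & f = poly_of_terms s).

Lemma seq_code_nat (c s : seq nat) : rcode (c := rseq (rnat k)) c s <-> c = s.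
Proof.
elim: c s => [|x c IH] [|y s] //; split; first by case=> -> /(IH s) ->.
by case=> -> /(IH s) Hs; split.
Qed.

Lemma computable_coord A (rA : coding k A) i (m : A -> mon) :
  computable rA rmon m -> computable rA (rnat k) (fun x => m x i).
Proof.
move=> Hm; apply: (@computable_ext _ _ _ _ _
  (fun x => nth 0%N [seq m x j | j <- enum 'I_n] i)).
  by move=> x; rewrite (nth_map i) ?size_enum_ord // nth_ord_enum.
apply: computable_nth.
apply: (computable_comp (g := fun m' : mon => [seq m' j | j <- enum 'I_n])) Hm.
by exists (PId _) => c x /= Hc; exists c => //; apply/seq_code_nat.
Qed.

(** The number of variables is fixed, so a monomial may be computed exponent by exponent. *)
Lemma computable_mon A (rA : coding k A) (m : A -> mon) :
  (forall i, computable rA (rnat k) (fun x => m x i)) -> computable rA rmon m.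
Proof.
move=> Hm; have [p Hp] := computable_const_map (enum 'I_n) Hm.
by exists p => c x /Hp[d pd /seq_code_nat Ed]; exists d.
Qed.

Lemma computable_forall A (rA : coding k A) (I : finType) (P : I -> A -> bool) :
  (forall i, computable rA (rbool k) (P i)) ->
  computable rA (rbool k) (fun x => [forall i, P i x]).
Proof.
move=> HP; apply: (@computable_ext _ _ _ _ _
  (fun x => all id [seq P i x | i <- enum I])).
  move=> x; rewrite all_map; apply/allP/forallP => [H i|H i _]; last exact: H.
  by apply: H; rewrite mem_enum.
by apply: computable_all; computability.
Qed.

Lemma computable_sum A (rA : coding k A) (I : finType) (F : I -> A -> nat) :
  (forall i, computable rA (rnat k) (F i)) ->
  computable rA (rnat k) (fun x => \sum_i F i x)%N.
Proof.
move=> HF; apply: (@computable_ext _ _ _ _ _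
  (fun x => sumn [seq F i x | i <- enum I])).
  by move=> x; rewrite sumnE big_map big_enum.
by apply: computable_sumn; computability.
Qed.

Section MonomialOperations.
Variables (A : Type) (rA : coding k A).
Variables m1 m2 : A -> mon.
Hypotheses (Hm1 : computable rA rmon m1) (Hm2 : computable rA rmon m2).

Lemma computable_mnm_add : computable rA rmon (fun x => m1 x + m2 x)%MM.
Proof.
apply: computable_mon => i.
apply: (@computable_ext _ _ _ _ _ (fun x => m1 x i + m2 x i)%N).
  by move=> x; rewrite mnmDE.
by apply: computable_add; apply: computable_coord.
Qed.

Lemma computable_mnm_sub : computable rA rmon (fun x => m1 x - m2 x)%MM.
Proof.
apply: computable_mon => i.
apply: (@computable_ext _ _ _ _ _ (fun x => m1 x i - m2 x i)%N).
  by move=> x; rewrite mnmBE.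
by apply: computable_sub; apply: computable_coord.
Qed.

Lemma computable_mlcm : computable rA rmon (fun x => mlcm (m1 x) (m2 x)).
Proof.
apply: computable_mon => i.
apply: (@computable_ext _ _ _ _ _ (fun x => maxn (m1 x i) (m2 x i))).
  by move=> x; rewrite mnmE.
by apply: computable_maxn; apply: computable_coord.
Qed.

Lemma computable_lem : computable rA (rbool k) (fun x => m1 x <= m2 x)%MM.
Proof.
by apply: computable_forall => i; apply: computable_leq; apply: computable_coord.
Qed.

Lemma computable_eqm : computable rA (rbool k) (fun x => m1 x == m2 x).
Proof.
apply: (@computable_ext _ _ _ _ _ (fun x => [forall i, m1 x i == m2 x i])).
  by move=> x; apply/forallP/eqP => [H|-> //]; apply/mnmP => i; apply/eqP.
by apply: computable_forall => i; apply: computable_eqn; apply: computable_coord.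
Qed.

Lemma computable_mdeg : computable rA (rnat k) (fun x => mdeg (m1 x)).
Proof.
apply: (@computable_ext _ _ _ _ _ (fun x => \sum_i m1 x i)%N).
  by move=> x; rewrite mdegE.
by apply: computable_sum => i; apply: computable_coord.
Qed.

End MonomialOperations.

(** The monomial order is the lexicographic order on the degree followed by the exponents;
    [None] stands for the degree. *)
Lemma computable_leo A (rA : coding k A) (m1 m2 : A -> mon) :
  computable rA rmon m1 -> computable rA rmon m2 ->
  computable rA (rbool k) (fun x => m1 x <= m2 x)%O.
Proof.
move=> Hm1 Hm2; pose F (m : A -> mon) (i : option 'I_n) x :=
  if i is Some j then m x j else mdeg (m x).
have HF m : computable rA rmon m -> forall i, computable rA (rnat k) (F m i).
  by move=> Hm [i|]; [apply: computable_coord | apply: computable_mdeg].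
pose s := None :: [seq Some i | i <- enum 'I_n].
apply: (@computable_ext _ _ _ _ _
  (fun x => [seq F m1 i x | i <- s] <= [seq F m2 i x | i <- s])%O).
  have E (m : mon) : val m = [seq m i | i <- enum 'I_n] :> seq nat.
    by rewrite -[LHS]map_tnth_enum.
  by move=> x; rewrite leEmnm !E /s /= -!map_comp.
by apply: computable_lexi; apply: HF.
Qed.

Lemma poly_of_cat s t : poly_of_terms (s ++ t) = poly_of_terms s + poly_of_terms t.
Proof. by rewrite /poly_of_terms big_cat. Qed.

Lemma poly_of_scale c a s :
  poly_of_terms [seq (c * t.1, a + t.2)%MM | t <- s] =
  c *: ('X_[a] * poly_of_terms s).
Proof.
rewrite /poly_of_terms big_map mulr_sumr scaler_sumr; apply: eq_bigr => t _ /=.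
by rewrite mpolyXD -scalerAr scalerA.
Qed.

Lemma mcoeff_poly_of s m :
  (poly_of_terms s)@_m = foldr (fun t r => if t.2 == m then t.1 + r else r) 0 s.
Proof.
elim: s => [|t s IH]; first by rewrite /poly_of_terms big_nil mcoeff0.
rewrite /poly_of_terms big_cons mcoeffD mcoeffZ mcoeffX IH /=.
by case: eqP => _; rewrite ?mulr1 // mulr0 add0r.
Qed.

(** A term of the list whose monomial cancels in the sum must not be taken into account. *)
Lemma mlead_poly_of s :
  mlead (poly_of_terms s) = foldr (fun t m =>
    if ((poly_of_terms s)@_(t.2) != 0) && (m <= t.2)%O then t.2 else m) 0%MM s.
Proof.
set f := poly_of_terms s.
have sub : {subset msupp f <= [seq t.2 | t <- s]}.
  move=> m /msupp_sum_le; rewrite filter_predT => /flattenP[_ /mapP[t ts ->]].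
  by move/msuppZ_le; rewrite msuppX inE => /eqP ->; apply: map_f.
have E u : foldr (fun t m => if (f@_(t.2) != 0) && (m <= t.2)%O then t.2 else m) 0%MM u
    = (\join_(m <- [seq t.2 | t <- u] | m \in msupp f) m)%O.
  elim: u => [|t u IH] /=; first by rewrite big_nil.
  rewrite big_cons IH -mcoeff_msupp; case: (_ \in _) => //=.
  by case: leP => [/join_l | /ltW /join_r].
rewrite E; apply: le_anti; apply/andP; split; last first.
  by apply/joinsP_seq => m _ /msupp_le_mlead.
by apply/joinsP_seq => m mf _; apply: joins_sup_seq => //; apply: sub.
Qed.

Lemma computable_mon_const A (rA : coding k A) (m : mon) : computable rA rmon (fun=> m).
Proof. by apply: computable_mon => i; apply: computable_nat. Qed.

Lemma computable_poly_of A (rA : coding k A) s :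
  computable rA rterms s -> computable rA rpoly (fun x => poly_of_terms (s x)).
Proof. by move=> [p Hp]; exists p => c x /Hp[d pd Hd]; exists d => //; exists (s x). Qed.

(** To compute with a polynomial, compute with any list of terms representing it: [F] may
    only depend on the sum. *)
Lemma computable_terms A (rA : coding k A) B (rB : coding k B) (F : A -> R -> B) (f : A -> R) :
  computable (rpair rA rterms) rB (fun p => F p.1 (poly_of_terms p.2)) ->
  computable rA rpoly f -> computable rA rB (fun x => F x (f x)).
Proof.
move=> [q Hq] [p Hp]; exists (PComp (PPair (PId _) p) q) => c x Hc.
have [d pd [s Hs ->]] := Hp _ _ Hc.
have [e qe He] := Hq (c, d) (x, s) (conj Hc Hs).
by exists e => //=; exists (c, d).
Qed.

Lemma computable_padd A (rA : coding k A) (f g : A -> R) :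
  computable rA rpoly f -> computable rA rpoly g ->
  computable rA rpoly (fun x => f x + g x).
Proof.
move=> Hf Hg.
apply: (computable_terms (F := fun x p => p + g x)) Hf.
apply: (computable_terms (F := fun x p => poly_of_terms x.2 + p)
  (f := fun x => g x.1)); last first.
  by apply: computable_comp Hg _; computability.
apply: (@computable_ext _ _ _ _ _ (fun x => poly_of_terms (x.1.2 ++ x.2))).
  by move=> x; rewrite poly_of_cat.
by apply: computable_poly_of; apply: computable_cat; computability.
Qed.

Lemma computable_pscale A (rA : coding k A) (c : A -> k) (a : A -> mon) (f : A -> R) :
  computable rA (rfield k) c -> computable rA rmon a -> computable rA rpoly f ->
  computable rA rpoly (fun x => c x *: ('X_[a x] * f x)).
Proof.
move=> Hc Ha.
apply: (computable_terms (F := fun x p => c x *: ('X_[a x] * p))).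
apply: (@computable_ext _ _ _ _ _ (fun x => poly_of_terms
   [seq (c x.1 * t.1, a x.1 + t.2)%MM | t <- x.2])).
  by move=> x; rewrite poly_of_scale.
apply: computable_poly_of; apply: computable_map; computability.
  apply: computable_fmul; computability.
  by apply: (computable_comp (f := fun x => x.1.1) Hc); computability.
apply: computable_mnm_add; computability.
by apply: (computable_comp (f := fun x => x.1.1) Ha); computability.
Qed.

Lemma computable_mcoeff A (rA : coding k A) (m : A -> mon) (f : A -> R) :
  computable rA rmon m -> computable rA rpoly f ->
  computable rA (rfield k) (fun x => (f x)@_(m x)).
Proof.
move=> Hm; apply: (computable_terms (F := fun x p => p@_(m x))).
apply: (@computable_ext _ _ _ _ _ (fun x =>
  foldr (fun t r => if t.2 == m x.1 then t.1 + r else r) 0 x.2)).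
  by move=> x; rewrite mcoeff_poly_of.
computability; first exact: computable_f0.
  apply: computable_eqm; computability.
  by apply: (computable_comp (f := fun x => x.1.1) Hm); computability.
by apply: computable_fadd; computability.
Qed.

Lemma computable_mlead A (rA : coding k A) (f : A -> R) :
  computable rA rpoly f -> computable rA rmon (fun x => mlead (f x)).
Proof.
apply: (computable_terms (F := fun x p => mlead p)).
apply: (@computable_ext _ _ _ _ _ (fun x => foldr (fun t m =>
    if ((poly_of_terms x.2)@_(t.2) != 0) && (m <= t.2)%O then t.2 else m) 0%MM x.2)).
  by move=> x; rewrite mlead_poly_of.
computability; first exact: computable_mon_const.
apply: computable_and; last by apply: computable_leo; computability.
apply: computable_neg; apply: computable_feq; last exact: computable_f0.
by apply: computable_mcoeff; computability; apply: computable_poly_of; computability.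
Qed.

Lemma computable_mleadc A (rA : coding k A) (f : A -> R) :
  computable rA rpoly f -> computable rA (rfield k) (fun x => mleadc (f x)).
Proof. by move=> Hf; apply: computable_mcoeff => //; apply: computable_mlead. Qed.

Lemma computable_peq0 A (rA : coding k A) (f : A -> R) :
  computable rA rpoly f -> computable rA (rbool k) (fun x => f x == 0).
Proof.
move=> Hf; apply: (@computable_ext _ _ _ _ _ (fun x => mleadc (f x) == 0)).
  by move=> x; rewrite mleadc_eq0.
by apply: computable_feq; [apply: computable_mleadc | apply: computable_f0].
Qed.

(** The common shape of [lred] and [spoly]. *)
Lemma computable_plincomb A (rA : coding k A) (c d : A -> k) (a b : A -> mon) (f g : A -> R) :
  computable rA (rfield k) c -> computable rA (rfield k) d ->
  computable rA rmon a -> computable rA rmon b ->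
  computable rA rpoly f -> computable rA rpoly g ->
  computable rA rpoly (fun x => c x *: ('X_[a x] * f x) - d x *: ('X_[b x] * g x)).
Proof.
move=> Hc Hd Ha Hb Hf Hg; apply: computable_padd; first exact: computable_pscale.
apply: (@computable_ext _ _ _ _ _ (fun x => (- d x) *: ('X_[b x] * g x))).
  by move=> x; rewrite scaleNr.
by apply: computable_pscale => //; apply: computable_fopp.
Qed.

Lemma computable_p0 A (rA : coding k A) : computable rA rpoly (fun=> 0).
Proof.
apply: (@computable_ext _ _ _ _ _ (fun=> poly_of_terms [::])).
  by move=> x; rewrite /poly_of_terms big_nil.
by apply: computable_poly_of; computability.
Qed.

Lemma computable_divides A (rA : coding k A) (f g : A -> R) :
  computable rA rpoly f -> computable rA rpoly g ->
  computable rA (rbool k) (fun x => divides (f x) (g x)).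
Proof.
move=> Hf Hg; apply: computable_and; last by apply: computable_lem; apply: computable_mlead.
by apply: computable_neg; apply: computable_peq0.
Qed.

Lemma computable_lred A (rA : coding k A) (f g : A -> R) :
  computable rA rpoly f -> computable rA rpoly g ->
  computable rA rpoly (fun x => lred (f x) (g x)).
Proof.
move=> Hf Hg; apply: (@computable_ext _ _ _ _ _ (fun x =>
  mleadc (f x) *: ('X_[0%MM] * g x) -
  mleadc (g x) *: ('X_[mlead (g x) - mlead (f x)] * f x))).
  by move=> x; rewrite mpolyX0 mul1r.
apply: computable_plincomb => //; try exact: computable_mleadc.
  exact: computable_mon_const.
by apply: computable_mnm_sub; apply: computable_mlead.
Qed.

Lemma computable_spoly A (rA : coding k A) (f g : A -> R) :
  computable rA rpoly f -> computable rA rpoly g ->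
  computable rA rpoly (fun x => spoly (f x) (g x)).
Proof.
move=> Hf Hg; apply: computable_plincomb => //; try exact: computable_mleadc;
by apply: computable_mnm_sub; [apply: computable_mlcm|]; apply: computable_mlead.
Qed.

Lemma computable_nf A (rA : coding k A) (G : A -> seq R) (f : A -> R) :
  computable rA (rseq rpoly) G -> computable rA rpoly f ->
  computable rA rpoly (fun x => nf (G x) (f x)).
Proof.
move=> HG Hf; rewrite /nf.
apply: (computable_app (f := fun H p => loop (red1_halts H) p) _ HG Hf).
apply: (@computable_loop _ _ _ _ _ (fun x f => reducible x.1 f)
  (fun x f => red1 x.1 f) (fun x => red1_halts x.1) snd); computability.
- apply: computable_and.
    by apply: computable_neg; apply: computable_peq0; computability.
  by apply: computable_has; computability; apply: computable_divides; computability.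
- rewrite /red1; computability.
    by apply: computable_divides; computability.
  by apply: computable_lred; computability.
Qed.

Lemma computable_new_generator A (rA : coding k A) (G : A -> seq R) :
  computable rA (rseq rpoly) G -> computable rA rpoly (fun x => new_generator (G x)).
Proof.
apply: (@computable_comp _ _ _ _ _ _ _ (@new_generator n k)).
rewrite /new_generator /spolys; computability.
- apply: computable_flatten; apply: computable_map; computability.
  apply: computable_map; computability.
  by apply: computable_nf; computability; apply: computable_spoly; computability.
- exact: computable_p0.
- by apply: computable_neg; apply: computable_peq0; computability.
Qed.

Lemma computable_buchberger A (rA : coding k A) (G : A -> seq R) :
  computable rA (rseq rpoly) G ->
  computable rA (rseq rpoly) (fun x => buchberger (G x)).
Proof.
move=> HG; rewrite /buchberger.
apply: (@computable_loop _ _ _ _ _ (fun _ G => new_generator G != 0)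
  (fun _ G => new_generator G :: G) (fun _ => @buchberger_halts n k)); computability.
- by apply: computable_neg; apply: computable_peq0; apply: computable_new_generator; computability.
- by apply: computable_new_generator; computability.
Qed.

Lemma computable_in_ideal A (rA : coding k A) (G : A -> seq R) (f : A -> R) :
  computable rA (rseq rpoly) G -> computable rA rpoly f ->
  computable rA (rbool k) (fun x => in_ideal (G x) (f x)).
Proof.
move=> HG Hf; apply: computable_peq0; apply: computable_nf => //.
exact: computable_buchberger.
Qed.

End Polynomials.

(** * Linear maps given on monomials *)

Section LinearExtension.
Variables (k : fieldType) (V : lmodType k).

Section Malg.
Variables (K : choiceType) (F : K -> V).
Implicit Types f g : {malg k[K]}.

Definition malg_lift f : V := \sum_(a <- monalg.msupp f) monalg.mcoeff a f *: F a.

(** The support may be enlarged, which makes additivity a matter of choosing a common one. *)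
Lemma malg_liftw f (d : {fset K}) : fsubset (monalg.msupp f) d ->
  malg_lift f = \sum_(a <- d) monalg.mcoeff a f *: F a.
Proof.
move=> le; rewrite /malg_lift (big_fset_incl _ le) //= => a _ /mcoeff_outdom ->.
by rewrite scale0r.
Qed.

Lemma malg_lift_linear c f g : malg_lift (c *: f + g) = c *: malg_lift f + malg_lift g.
Proof.
set d := fsetU (monalg.msupp f) (monalg.msupp g).
have le : fsubset (monalg.msupp (c *: f + g)) d.
  apply: fsubset_trans (monalg.msuppD_le _ _) _.
  exact: fsetSU (monalg.msuppZ_le _ _).
rewrite (malg_liftw le) (malg_liftw (fsubsetUl _ _ : fsubset (monalg.msupp f) d)).
rewrite (malg_liftw (fsubsetUr _ _ : fsubset (monalg.msupp g) d)).
rewrite scaler_sumr -big_split /=; apply: eq_bigr => a _.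
by rewrite monalg.mcoeffD monalg.mcoeffZ scalerDl scalerA.
Qed.

Lemma malg_liftU c a : malg_lift << c *g a >> = c *: F a.
Proof. by rewrite (malg_liftw msuppU_le) big_seq_fset1 mcoeffUU. Qed.

Lemma malg_lift_sum I (r : seq I) (G : I -> {malg k[K]}) :
  malg_lift (\sum_(i <- r) G i) = \sum_(i <- r) malg_lift (G i).
Proof.
elim: r => [|i r IH]; last by rewrite !big_cons -IH -[G i]scale1r malg_lift_linear !scale1r.
by rewrite !big_nil /malg_lift monalg.msupp0 big_seq_fset0.
Qed.

End Malg.

Section Mpoly.
Variables (n : nat) (F : 'X_{1..n} -> V).
Implicit Types f g : mpoly n k.

Definition mpoly_lift f : V := \sum_(m <- msupp f) f@_m *: F m.

Lemma mpoly_liftw f (s : seq 'X_{1..n}) : uniq s -> {subset msupp f <= s} ->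
  mpoly_lift f = \sum_(m <- s) f@_m *: F m.
Proof.
move=> us le; rewrite (bigID (mem (msupp f))) /= [X in _ + X]big1 ?addr0; last first.
  by move=> m /memN_msupp_eq0 ->; rewrite scale0r.
rewrite -big_filter; apply: perm_big; apply: uniq_perm => [||m].
- exact: msupp_uniq.
- exact: filter_uniq.
by rewrite mem_filter andb_idr //; apply: le.
Qed.

Lemma mpoly_lift_linear c f g :
  mpoly_lift (c *: f + g) = c *: mpoly_lift f + mpoly_lift g.
Proof.
pose s := undup (msupp f ++ msupp g).
have le h : {subset msupp h <= msupp f ++ msupp g} -> {subset msupp h <= s}.
  by move=> hs m /hs; rewrite mem_undup.
rewrite !(@mpoly_liftw _ s) ?undup_uniq //;
  try by apply: le => m; rewrite mem_cat => ->; rewrite ?orbT.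
  rewrite scaler_sumr -big_split /=; apply: eq_bigr => m _.
  by rewrite mcoeffD mcoeffZ scalerDl scalerA.
by apply: le => m /msuppD_le; rewrite !mem_cat => /orP[/msuppZ_le ->|->]; rewrite ?orbT.
Qed.

Lemma mpoly_liftX m : mpoly_lift 'X_[m] = F m.
Proof. by rewrite /mpoly_lift msuppX big_seq1 mcoeffX eqxx scale1r. Qed.

End Mpoly.
End LinearExtension.

Lemma malg_span (k : fieldType) (K : choiceType) (f : {malg k[K]}) :
  lin_span (fun g => exists a, g = << 1 *g a >>) f.
Proof.
rewrite [f]monalgE; apply: lin_span_sum => a.
have -> : << monalg.mcoeff a f *g a >> = monalg.mcoeff a f *: << 1 *g a >>.
  by apply/malgP => b; rewrite monalg.mcoeffZ !mcoeffU mulrnAr mulr1.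
by apply: lin_spanZ; apply: lin_span_in; exists a.
Qed.

(** * Ideals of the free commutative dialgebra as polynomial ideals *)

Section Embedding.
Variables (k : fieldType) (X : finType).

Local Notation N := #|{: X + bool}|.
Local Notation mon := 'X_{1..N}.
Local Notation R := (mpoly N k).
Local Notation D := (Di k X).
Local Notation basis a := (<< 1 *g a >> : D).
Implicit Types (m : mon) (u : csg X) (w : {cmonom X}) (a b : dsym X) (x y t : X) (f g : D).

Definition var (s : X + bool) : mon := U_(enum_rank s)%MM.

Definition word_mon w : mon :=
  [multinom (if enum_val i is inl x then w x else 0%N) | i < N].

Definition second a : bool := if a is inr _ then true else false.

(** The variables are the letters together with two marks, false for z and true for w, which
    record the kind of the symbol. *)
Definition sym_mon a : mon := (word_mon (val (dsym_word a)) + var (inr (second a)))%MM.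

(** Exponents indexed by the variables themselves instead of their ranks. *)
Definition exponent m (s : X + bool) : nat := m (enum_rank s).

Lemma exponentD m1 m2 s : exponent (m1 + m2) s = (exponent m1 s + exponent m2 s)%N.
Proof. exact: mnmDE. Qed.

Lemma exponent_var s s' : exponent (var s) s' = (s == s').
Proof. by rewrite /exponent mnm1E (inj_eq enum_rank_inj). Qed.

Lemma exponent_word w s :
  exponent (word_mon w) s = if s is inl x then w x else 0%N.
Proof. by rewrite /exponent mnmE enum_rankK. Qed.

Definition exponentE := (exponentD, exponent_var, exponent_word).

Lemma exponentP m1 m2 : exponent m1 =1 exponent m2 -> m1 = m2.
Proof. by move=> E; apply/mnmP => i; rewrite -(enum_valK i); apply: E. Qed.

Lemma word_monM w w' : word_mon (mmul w w') = (word_mon w + word_mon w')%MM.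
Proof. by apply: exponentP => -[x|b]; rewrite !exponentE // cmM. Qed.

(** Both operations of the dialgebra multiply the words and then choose the kind of the
    resulting symbol: [symbol _ false] for -|, [symbol _ true] for |-. *)
Definition symbol (u : csg X) (snd : bool) : dsym X :=
  if snd then (if insub u is Some v then inr v else inl u) else inl u.

Lemma symbolK a : symbol (dsym_word a) (second a) = a.
Proof. by case: a => [u //|v]; rewrite /symbol /= valK. Qed.

Lemma dsym_dvE a b : dsym_dv a b = symbol (csg_mul (dsym_word a) (dsym_word b)) false.
Proof. by []. Qed.

Lemma dsym_vdE a b : dsym_vd a b = symbol (csg_mul (dsym_word a) (dsym_word b)) true.
Proof. by []. Qed.

Lemma dsym_word_symbol u s : dsym_word (symbol u s) = u.
Proof. by case: s => //=; case: insubP => //= v _ ->. Qed.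

Lemma symbol_long u s : csg_len u != 2%N -> symbol u s = inl u.
Proof. by move=> lu; case: s => //=; rewrite insubN. Qed.

Lemma csg_lenM (u v : csg X) : csg_len (csg_mul u v) = (csg_len u + csg_len v)%N.
Proof. exact: monalg.mdegM. Qed.

Lemma csg_len_gt0 (u : csg X) : (0 < csg_len u)%N.
Proof. exact: (valP u). Qed.

Lemma second_long a : second a -> csg_len (dsym_word a) = 2%N.
Proof. by case: a => // v _; apply/eqP; apply: (valP v). Qed.

Definition mon_word m : {cmonom X} :=
  [cmonom exponent m (inl x) | x in [fset x | x : X]%fset]%M.

Lemma mon_wordE m x : mon_word m x = exponent m (inl x).
Proof. by rewrite cmE fsfun_fun in_imfset. Qed.

Lemma mon_wordD m1 m2 : mon_word (m1 + m2) = mmul (mon_word m1) (mon_word m2).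
Proof. by apply/eqP/cmP => x; rewrite cmM !mon_wordE exponentD. Qed.

Lemma word_monK w : mon_word (word_mon w) = w.
Proof. by apply/eqP/cmP => x; rewrite mon_wordE exponent_word. Qed.

Lemma mon_word_var (e : bool) : mon_word (var (inr e)) = mone.
Proof. by apply/eqP/cmP => x; rewrite mon_wordE exponent_var cm1. Qed.

Lemma mon_word_letter x : mon_word (var (inl x)) = ucm x.
Proof. by apply/eqP/cmP => y; rewrite mon_wordE exponent_var cmU. Qed.

Lemma mon_word_sym a : mon_word (sym_mon a) = val (dsym_word a).
Proof. by rewrite mon_wordD word_monK mon_word_var mulm1. Qed.

Definition marks m : nat := (exponent m (inr false) + exponent m (inr true))%N.

Lemma marksD m1 m2 : marks (m1 + m2) = (marks m1 + marks m2)%N.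
Proof. by rewrite /marks !exponentD addnACA. Qed.

Lemma marks_sym a : marks (sym_mon a) = 1%N.
Proof. by rewrite /marks !exponentE; case: (second a). Qed.

Lemma marks_var (e : bool) : marks (var (inr e)) = 1%N.
Proof. by rewrite /marks !exponentE; case: e. Qed.

(** The inverse of [sym_mon], extended to all monomials.  A word of length greater than 2
    gives the same symbol with either mark, which is what makes [retract] vanish on the
    binomials below; monomials without exactly one mark go to 0. *)
Definition mon_val m : D :=
  if marks m == 1%N then
    if insub (mon_word m) is Some u
    then << 1 *g symbol u (exponent m (inr true) == 1%N) >> else 0
  else 0.

Lemma mon_val_marks m : marks m != 1%N -> mon_val m = 0.
Proof. by rewrite /mon_val => /negbTE ->. Qed.

Definition emb : D -> R := malg_lift (fun a => 'X_[sym_mon a]).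
Definition retract : R -> D := mpoly_lift mon_val.

Lemma mon_valE m (u : csg X) : marks m = 1%N -> mon_word m = val u ->
  mon_val m = << 1 *g symbol u (exponent m (inr true) == 1%N) >>.
Proof. by rewrite /mon_val => -> ->; rewrite eqxx valK. Qed.

Lemma second_exponent a : (exponent (sym_mon a) (inr true) == 1%N) = second a.
Proof. by rewrite !exponentE; case: (second a). Qed.

Lemma mon_val_sym a : mon_val (sym_mon a) = << 1 *g a >>.
Proof.
rewrite (mon_valE (marks_sym a) (mon_word_sym a)).
by rewrite second_exponent symbolK.
Qed.

Lemma malg_linear_ext (V : lmodType k) (L M : D -> V) :
  (forall c f g, L (c *: f + g) = c *: L f + L g) ->
  (forall c f g, M (c *: f + g) = c *: M f + M g) ->
  (forall a, L << 1 *g a >> = M << 1 *g a >>) -> L =1 M.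
Proof.
move=> linL linM LM f; elim: (malg_span f) => [|c _ g [a ->] _ IH].
  by rewrite (linear_map0 linL) (linear_map0 linM).
by rewrite linL linM LM IH.
Qed.

Lemma embU a : emb << 1 *g a >> = 'X_[sym_mon a].
Proof. by rewrite /emb malg_liftU scale1r. Qed.

Lemma retractX m : retract 'X_[m] = mon_val m.
Proof. exact: mpoly_liftX. Qed.

Lemma emb_linear c f g : emb (c *: f + g) = c *: emb f + emb g.
Proof. exact: malg_lift_linear. Qed.

Lemma retract_linear c (p q : R) : retract (c *: p + q) = c *: retract p + retract q.
Proof. exact: mpoly_lift_linear. Qed.

Lemma embK f : retract (emb f) = f.
Proof.
apply: (malg_linear_ext (L := fun f => retract (emb f)) (M := id)) => // [c p q|a].
  by rewrite emb_linear retract_linear.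
by rewrite embU retractX mon_val_sym.
Qed.

Lemma letter_proof x : (0 < monalg.mdeg (ucm x))%N.
Proof. by rewrite monalg.mdegU. Qed.

Definition letter x : dsym X := inl (Sub (ucm x) (letter_proof x)).

(** Three letters suffice: a word of length at least 3 is a multiple of such a monomial. *)
Definition cubic (p : X * X * X) : mon :=
  (var (inl p.1.1) + (var (inl p.1.2) + var (inl p.2)))%MM.

Definition cubic_gens : seq R :=
  [seq 'X_[cubic p + var (inr true)] - 'X_[cubic p + var (inr false)] | p <- enum {: X * X * X}].

(** The products by |- with a letter are the only ones that differ from the action of the
    polynomials in X. *)
Definition element_gens f : seq R :=
  emb f :: [seq emb (di_vd f (basis (letter x))) | x <- enum X].

Definition gens (S : seq D) : seq R :=
  cubic_gens ++ flatten [seq element_gens s | s <- S].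

Lemma gens_cubic S p :
  'X_[cubic p + var (inr true)] - 'X_[cubic p + var (inr false)] \in gens S.
Proof.
rewrite mem_cat; apply/orP; left.
by apply/mapP; exists p; rewrite ?mem_enum.
Qed.

Lemma gens_element S s p : s \in S -> p \in element_gens s -> p \in gens S.
Proof.
move=> sS ps; rewrite mem_cat; apply/orP; right.
by apply/flatten_mapP; exists s.
Qed.

Definition Id_of_seq (S : seq D) : D -> Prop :=
  gen_ideal (@di_vd k X) (@di_dv k X) (fun s => s \in S).

Lemma gen_ideal_di_ideal (P : D -> Prop) :
  di_ideal (@di_vd k X) (@di_dv k X) (gen_ideal (@di_vd k X) (@di_dv k X) P).
Proof.
split.
- by move=> I [].
- by move=> a b Ia Ib I HI PI; apply: (idealD HI); [apply: Ia | apply: Ib].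
- by move=> c a Ia I HI PI; apply: (idealZ HI); apply: Ia.
- by move=> a b Ia I HI PI; apply: (ideal_vdl HI); apply: Ia.
- by move=> a b Ia I HI PI; apply: (ideal_vdr HI); apply: Ia.
- by move=> a b Ia I HI PI; apply: (ideal_dvl HI); apply: Ia.
- by move=> a b Ia I HI PI; apply: (ideal_dvr HI); apply: Ia.
Qed.

Lemma di_vdU a b : di_vd (basis a) (basis b) = basis (dsym_vd a b).
Proof. by rewrite /di_vd bilin_extUU mulr1. Qed.

Lemma di_dvU a b : di_dv (basis a) (basis b) = basis (dsym_dv a b).
Proof. by rewrite /di_dv bilin_extUU mulr1. Qed.

Lemma di_vd_linear h c f g : di_vd (c *: f + g) h = c *: di_vd f h + di_vd g h.
Proof. by have [lin _] := @bilin_ext_bilinear k X (@dsym_vd X); apply: lin. Qed.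

Lemma di_dv_linear h c f g : di_dv (c *: f + g) h = c *: di_dv f h + di_dv g h.
Proof. by have [lin _] := @bilin_ext_bilinear k X (@dsym_dv X); apply: lin. Qed.

(** The two monomials may differ by the choice of their marks. *)
Lemma mon_val_swap_mark m m' : mon_word m = mon_word m' -> marks m = marks m' ->
  (2 < monalg.mdeg (mon_word m))%N -> mon_val m = mon_val m'.
Proof.
rewrite /mon_val => <- <- lm; case: ifP => // _; case: insubP => //= u _ Eu.
rewrite -Eu in lm; have lu : csg_len u != 2%N by apply: contraTN lm => /eqP; rewrite /csg_len => ->.
by rewrite !symbol_long.
Qed.

Lemma marks0 m : marks m = 0%N -> forall e, exponent m (inr e) = 0%N.
Proof.
by rewrite /marks => /eqP; rewrite addn_eq0 => /andP[/eqP e0 /eqP e1] [].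
Qed.

(** An element in the image of [emb] is already homogeneous of degree 1 in the marks. *)
Lemma retract_mul_marked m f : marks m != 0%N -> retract ('X_[m] * emb f) = 0.
Proof.
move=> m0; apply: (malg_linear_ext (L := fun f => retract ('X_[m] * emb f)) (M := fun=> 0)).
- by move=> c p q; rewrite emb_linear mulrDr -scalerAr retract_linear.
- by move=> c p q; rewrite scaler0 addr0.
move=> a; rewrite embU -mpolyXD retractX mon_val_marks //.
by rewrite marksD marks_sym addn1 eqSS.
Qed.

Lemma retract_mul_unit m f : marks m = 0%N -> mon_word m = mone ->
  retract ('X_[m] * emb f) = f.
Proof.
move=> m0 wm; suff -> : m = 0%MM by rewrite mpolyX0 mul1r embK.
apply: exponentP => -[x|e]; rewrite [RHS]mnmE; last exact: marks0.
by rewrite -mon_wordE wm cm1.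
Qed.

(** If the symbol is of the second kind, its word has length 2, so the product is long and
    the mark is forgotten on both sides. *)
Lemma retract_mul_word m u f : marks m = 0%N -> mon_word m = val u ->
  retract ('X_[m] * emb f) = di_dv f (basis (inl u)).
Proof.
move=> m0 wm; apply: (malg_linear_ext (L := fun f => retract ('X_[m] * emb f))
  (M := fun f => di_dv f (basis (inl u)))).
- by move=> c p q; rewrite emb_linear mulrDr -scalerAr retract_linear.
- by move=> c p q; apply: di_dv_linear.
move=> a; rewrite embU -mpolyXD retractX di_dvU.
rewrite (@mon_valE _ (csg_mul (dsym_word a) u)).
- rewrite exponentD marks0 // add0n second_exponent.
  case sa: (second a) => //; rewrite symbol_long // csg_lenM second_long //.
  by rewrite -{2}[2%N]addn0 eqn_add2l -lt0n csg_len_gt0.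
- by rewrite marksD marks_sym m0.
by rewrite mon_wordD mon_word_sym wm mulmC.
Qed.

Lemma retract_mul_ideal (I : D -> Prop) m f : di_ideal (@di_vd k X) (@di_dv k X) I ->
  I f -> I (retract ('X_[m] * emb f)).
Proof.
move=> HI If; have [m0|m0] := eqVneq (marks m) 0%N; last first.
  by rewrite retract_mul_marked //; apply: ideal0 HI.
have [wm|wm] := eqVneq (mon_word m) mone; first by rewrite retract_mul_unit.
have mw : (0 < monalg.mdeg (mon_word m))%N by rewrite lt0n monalg.mdeg_eq0.
rewrite (@retract_mul_word _ (Sub (mon_word m) mw)) ?SubK //.
exact: (ideal_dvl HI).
Qed.

Lemma mdeg_cubic p : monalg.mdeg (mon_word (cubic p)) = 3%N.
Proof.
by rewrite /cubic !mon_wordD !mon_word_letter !monalg.mdegM !monalg.mdegU.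
Qed.

Lemma retract_ideal S p : ideal (gens S) p -> Id_of_seq S (retract p).
Proof.
have IS := gen_ideal_di_ideal (fun s => s \in S).
elim=> [|c _ q [m [g [gS ->]]] _ IH].
  by rewrite (linear_map0 retract_linear); apply: ideal0 IS.
rewrite retract_linear; apply: (idealD IS) IH; apply: (idealZ IS).
move: gS; rewrite mem_cat => /orP[/mapP[r _ ->]|/flatten_mapP[s sS]].
  rewrite mulrBr -!mpolyXD -scaleN1r addrC retract_linear !retractX scaleN1r.
  rewrite (@mon_val_swap_mark _ (m + (cubic r + var (inr true)))%MM) ?addNr.
  - exact: ideal0 IS.
  - by rewrite !mon_wordD !mon_word_var.
  - by rewrite !marksD !marks_var.
  by rewrite 2!mon_wordD !monalg.mdegM mdeg_cubic addnCA.
have Is : Id_of_seq S s by move=> I _; apply.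
rewrite inE => /predU1P[->|/mapP[x _ ->]]; apply: (retract_mul_ideal _ IS) => //.
exact: (ideal_vdl IS).
Qed.

Lemma take_letter m : (0 < monalg.mdeg (mon_word m))%N ->
  exists x m', m = (var (inl x) + m')%MM /\
    monalg.mdeg (mon_word m) = (monalg.mdeg (mon_word m')).+1.
Proof.
move=> m0; have [x mx] : exists x, exponent m (inl x) != 0%N.
  apply/existsP; apply: contraLR m0; rewrite negb_exists -eqn0Ngt => /forallP m0.
  rewrite monalg.mdeg_eq0; apply/cmP => x; rewrite cm1 mon_wordE.
  by apply/eqP; rewrite -[_ == _]negbK.
have E : m = (var (inl x) + (m - var (inl x)))%MM by rewrite addmC submK // lep1mP.
exists x, (m - var (inl x))%MM; split=> //; rewrite {1}E mon_wordD monalg.mdegM.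
by rewrite mon_word_letter monalg.mdegU.
Qed.

Lemma letter_sym a : csg_len (dsym_word a) = 1%N -> exists x, a = letter x.
Proof.
case: a => [u|v] /= lu; last by have := valP v; rewrite lu.
have [|x [m' [Em]]] := @take_letter (word_mon (val u)).
  by rewrite word_monK; apply: (valP u).
rewrite word_monK -/(csg_len u) lu => -[/esym/eqP]; rewrite monalg.mdeg_eq0 => /eqP m'1.
exists x; congr inl; apply: val_inj; rewrite SubK -[LHS]word_monK Em mon_wordD m'1 mulm1.
exact: mon_word_letter.
Qed.

Section Containment.
Variable S : seq D.
Local Notation J := (ideal (gens S)).

Lemma ideal_long w : (2 < monalg.mdeg w)%N ->
  J ('X_[word_mon w + var (inr true)] - 'X_[word_mon w + var (inr false)]).
Proof.
rewrite -{1}(word_monK w); move: (word_mon w) => m mw.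
have [|x [m1 [Em E1]]] := @take_letter m; first exact: leq_trans mw.
rewrite {}E1 ltnS in mw.
have [|y [m2 [Em1 E2]]] := @take_letter m1; first exact: leq_trans mw.
rewrite {}E2 ltnS in mw; have [t [m3 [Em2 _]]] := take_letter mw.
have E e : (var (inl x) + (var (inl y) + (var (inl t) + m3)) + var (inr e) =
    m3 + (cubic (x, y, t) + var (inr e)))%MM.
  by rewrite /cubic /= !addmA; congr (_ + _)%MM; rewrite addmC -!addmA.
rewrite Em Em1 Em2 !E !mpolyXD -mulrBr; apply: ideal_mulX_mem.
by rewrite -!mpolyXD; apply: gens_cubic.
Qed.

(** The two polynomials agree except on symbols of the second kind, where -| replaces the
    mark w by z; the word is then long enough for a binomial to compensate. *)
Lemma emb_dv_shift f b : J (emb (di_dv f (basis b)) -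
  'X_[word_mon (val (dsym_word b))] * emb f).
Proof.
pose L f := emb (di_dv f (basis b)) - 'X_[word_mon (val (dsym_word b))] * emb f.
apply: (lin_span_linear (L := L)) (malg_span f).
  move=> c p q; rewrite /L di_dv_linear !emb_linear mulrDr -scalerAr opprD.
  by rewrite addrACA -scalerBr.
move=> _ [a ->]; rewrite -/J /L di_dvU !embU -mpolyXD.
rewrite {1}/sym_mon /= word_monM.
have -> : (word_mon (val (dsym_word b)) + sym_mon a = word_mon (val (dsym_word a)) +
   word_mon (val (dsym_word b)) + var (inr (second a)))%MM.
  by rewrite /sym_mon addmA (addmC (word_mon (val (dsym_word b)))).
case sa: (second a); last by rewrite subrr; apply: lin_span0.
rewrite -opprB -scaleN1r -word_monM; apply: lin_spanZ; apply: ideal_long.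
rewrite monalg.mdegM -!/(csg_len _) (second_long sa) addSn addSn ltnS ltnS.
exact: csg_len_gt0.
Qed.

Lemma emb_dv f b : J (emb f) -> J (emb (di_dv f (basis b))).
Proof.
move=> Jf; rewrite -[emb (di_dv _ _)](subrK ('X_[word_mon (val (dsym_word b))] * emb f)).
by apply: lin_spanD; [apply: emb_dv_shift | apply: ideal_mulX].
Qed.

Lemma di_vd_long f b : csg_len (dsym_word b) != 1%N ->
  di_vd f (basis b) = di_dv f (basis b).
Proof.
move=> lb; apply: (malg_linear_ext (L := fun f => di_vd f (basis b))
  (M := fun f => di_dv f (basis b))).
- by move=> c p q; apply: di_vd_linear.
- by move=> c p q; apply: di_dv_linear.
move=> a; rewrite di_vdU di_dvU dsym_vdE dsym_dvE symbol_long // csg_lenM.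
move: lb (csg_len_gt0 (dsym_word a)) (csg_len_gt0 (dsym_word b)).
by case: (csg_len _) => [|[|?]] //; case: (csg_len _) => [|?] // *; rewrite !addSn !addnS.
Qed.

(** Every word occurring in a product has length at least 2, so a further product does not
    distinguish the two operations. *)
Lemma di_vd_product f b c : di_vd (di_dv f (basis b)) (basis c) =
    di_dv (di_dv f (basis b)) (basis c) /\
  di_vd (di_vd f (basis b)) (basis c) = di_dv (di_vd f (basis b)) (basis c).
Proof.
have E a b' s : dsym_vd (symbol (csg_mul (dsym_word a) (dsym_word b')) s) c =
    dsym_dv (symbol (csg_mul (dsym_word a) (dsym_word b')) s) c.
  rewrite dsym_vdE dsym_dvE dsym_word_symbol symbol_long // csg_lenM csg_lenM.
  by move: (csg_len_gt0 (dsym_word a)) (csg_len_gt0 (dsym_word b')) (csg_len_gt0 (dsym_word c));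
    case: (csg_len _) => [|?] //; case: (csg_len _) => [|?] //;
    case: (csg_len _) => [|?] // _ _ _; rewrite !addSn !addnS.
split.
  apply: (malg_linear_ext (L := fun f => di_vd (di_dv f (basis b)) (basis c))
    (M := fun f => di_dv (di_dv f (basis b)) (basis c))) => [d p q|d p q|a].
  - by rewrite di_dv_linear di_vd_linear.
  - by rewrite !di_dv_linear.
  by rewrite !di_dvU di_vdU (dsym_dvE a b) E.
apply: (malg_linear_ext (L := fun f => di_vd (di_vd f (basis b)) (basis c))
    (M := fun f => di_dv (di_vd f (basis b)) (basis c))) => [d p q|d p q|a].
- by rewrite !di_vd_linear.
- by rewrite di_vd_linear di_dv_linear.
by rewrite !di_vdU di_dvU (dsym_vdE a b) E.
Qed.

(** The first condition alone is not visibly preserved by |- with a letter, which does not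
    come from a multiplication of polynomials; hence the second one. *)
Definition stable f := J (emb f) /\ forall x, J (emb (di_vd f (basis (letter x)))).

Lemma stable_linear c f g : stable f -> stable g -> stable (c *: f + g).
Proof.
move=> [Jf Jfx] [Jg Jgx]; split=> [|x].
  by rewrite emb_linear; apply: lin_spanD Jg; apply: lin_spanZ.
by rewrite di_vd_linear emb_linear; apply: lin_spanD (Jgx x); apply: lin_spanZ (Jfx x).
Qed.

Lemma stable0 : stable 0.
Proof.
have E0 : emb 0 = 0 by rewrite (linear_map0 emb_linear).
by split=> [|x]; rewrite ?(linear_map0 (di_vd_linear _)) E0; apply: lin_span0.
Qed.

Lemma stable_dv f b : stable f -> stable (di_dv f (basis b)).
Proof.
move=> [Jf _]; split=> [|x]; first exact: emb_dv.
by rewrite (proj1 (di_vd_product f b (letter x))); do 2! apply: emb_dv.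
Qed.

Lemma stable_vd f b : stable f -> stable (di_vd f (basis b)).
Proof.
move=> [Jf Jfx]; have Jfb : J (emb (di_vd f (basis b))).
  have [/letter_sym[x ->] //|lb] := eqVneq (csg_len (dsym_word b)) 1%N.
  by rewrite di_vd_long //; apply: emb_dv.
split=> [|x]; first exact: Jfb.
by rewrite (proj2 (di_vd_product f b (letter x))); apply: emb_dv Jfb.
Qed.

(** By linearity only products with basis symbols matter.  Those by a letter with |- are in
    the definition, all others are multiplications of polynomials modulo the
    binomials; after one product the additional condition is automatic. *)
Lemma stable_ideal : di_ideal (@di_vd k X) (@di_dv k X) stable.
Proof.
have [[_ vdr] [_ dvr] _ _ vdC dvC _ _ _] := Di_comm_dialgebra k X.
have vd f g : stable f -> stable (di_vd f g).
  move=> If; elim: (malg_span g) => [|c _ h [b ->] _ IH].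
    by rewrite (linear_map0 (fun c => vdr c f)); apply: stable0.
  by rewrite vdr; apply: stable_linear IH; apply: stable_vd.
have dv f g : stable f -> stable (di_dv f g).
  move=> If; elim: (malg_span g) => [|c _ h [b ->] _ IH].
    by rewrite (linear_map0 (fun c => dvr c f)); apply: stable0.
  by rewrite dvr; apply: stable_linear IH; apply: stable_dv.
split.
- exact: stable0.
- by move=> f g If Ig; rewrite -[f]scale1r; apply: stable_linear.
- by move=> c f If; rewrite -[c *: f]addr0; apply: stable_linear stable0.
- by move=> f g If; apply: vd.
- by move=> f g If; rewrite vdC; apply: vd.
- by move=> f g If; apply: dv.
- by move=> f g If; rewrite dvC; apply: dv.
Qed.

Lemma ideal_gensP f : J (emb f) <-> Id_of_seq S f.
Proof.
split=> [/retract_ideal|]; first by rewrite embK.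
move=> /(_ _ stable_ideal) []// s sS; split=> [|x]; apply: ideal_mem.
  by apply: gens_element sS _; rewrite inE eqxx.
by apply: gens_element sS _; rewrite inE; apply/orP; right; apply: map_f; rewrite mem_enum.
Qed.

End Containment.
End Embedding.

(** * Computability of the reduction to polynomials *)

Section Decision.
Variables (k : fieldType) (X : finType).
Local Notation N := #|{: X + bool}|.
Local Notation D := (Di k X).

Definition rsym : coding k (dsym X) := @Coding k _ TSym (fun c a => c = sym_code k a).

Definition rdterms : coding k (seq (k * dsym X)) := rseq (rpair (rfield k) rsym).

Lemma computable_second A (rA : coding k A) (a : A -> dsym X) :
  computable rA rsym a -> computable rA (rbool k) (fun x => second (a x)).
Proof.
apply: computable_comp; exists (PFst _ _) => c b ->; exists (second b); last by [].
by case: b.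
Qed.

Lemma computable_word A (rA : coding k A) (a : A -> dsym X) (y : X) :
  computable rA rsym a -> computable rA (rnat k) (fun x => val (dsym_word (a x)) y).
Proof.
move=> Ha; apply: (@computable_ext _ _ _ _ _
  (fun x => nth 0%N [seq val (dsym_word (a x)) z | z <- enum X] (index y (enum X)))).
  by move=> x; rewrite (nth_map y) ?nth_index ?index_mem ?mem_enum.
apply: computable_nth.
apply: (computable_comp (g := fun b => [seq val (dsym_word b) z | z <- enum X])) Ha.
by exists (PSnd _ _) => c b ->; eexists; [reflexivity | apply/seq_code_nat].
Qed.

Lemma sym_monE (a : dsym X) s : exponent (sym_mon a) s =
  match s with inl x => val (dsym_word a) x | inr e => second a == e : nat end.
Proof. by rewrite !exponentE; case: s => [x|e]; rewrite ?addn0 ?add0n. Qed.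

Lemma mdeg_sum (w : {cmonom X}) : monalg.mdeg w = (\sum_x w x)%N.
Proof.
rewrite (@monalg.mdegEw _ w [fset x | x : X]%fset); last first.
  by apply/fsubsetP => x _; apply: in_imfset.
rewrite -big_enum; apply: perm_big; apply: uniq_perm.
- exact: fset_uniq.
- exact: enum_uniq.
by move=> x; rewrite mem_enum; apply: in_imfset.
Qed.

(** How a program recognizes, from the exponents alone, that the product with a letter is of
    the second kind. *)
Lemma second_vd_letter (a : dsym X) x :
  second (dsym_vd a (letter x)) = (csg_len (dsym_word a) == 1%N).
Proof.
have -> : (csg_len (dsym_word a) == 1%N) =
    (csg_len (csg_mul (dsym_word a) (dsym_word (letter x))) == 2%N).
  by rewrite csg_lenM [X in (_ + X)%N]monalg.mdegU addn1 eqSS.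
rewrite dsym_vdE /symbol; case: insubP => [u -> _ //|/negbTE -> //].
Qed.

Section SymbolMonomials.
Variables (A : Type) (rA : coding k A) (a : A -> dsym X).
Hypothesis Ha : computable rA rsym a.

Lemma computable_sym_mon : computable rA (rmon k N) (fun x => sym_mon (a x)).
Proof.
apply: computable_mon => i; pose s := enum_val i.
apply: (@computable_ext _ _ _ _ _ (fun x =>
  match s with inl y => val (dsym_word (a x)) y | inr e => second (a x) == e : nat end)).
  by move=> x; rewrite -sym_monE /exponent enum_valK.
case: s => [y|e]; first exact: computable_word.
apply: (@computable_ext _ _ _ _ _ (fun x => if second (a x) then e : nat else ~~ e : nat)).
  by move=> x; case: (second _); case: e.
by computability; apply: computable_second.
Qed.

Lemma computable_vd_letter y :
  computable rA (rmon k N) (fun x => sym_mon (dsym_vd (a x) (letter y))).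
Proof.
apply: computable_mon => i; pose s := enum_val i.
apply: (@computable_ext _ _ _ _ _ (fun x =>
  match s with
  | inl z => val (dsym_word (a x)) z + (y == z)
  | inr e => (\sum_z val (dsym_word (a x)) z == 1)%N == e end)%N).
  move=> x; transitivity (exponent (sym_mon (dsym_vd (a x) (letter y))) s); last first.
    by rewrite /exponent enum_valK.
  rewrite sym_monE; case: s => [z|e]; first by rewrite dsym_word_vd cmM cmU.
  by rewrite second_vd_letter /csg_len mdeg_sum.
case: s => [z|e].
  by apply: computable_add; [apply: computable_word | apply: computable_nat].
apply: (@computable_ext _ _ _ _ _ (fun x =>
  if (\sum_z val (dsym_word (a x)) z == 1)%N then e : nat else ~~ e : nat)).
  by move=> x; case: (_ == 1)%N; case: e.
computability; apply: computable_eqn; last exact: computable_nat.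
by apply: computable_sum => z; apply: computable_word.
Qed.

End SymbolMonomials.

Lemma emb_terms (ts : seq (k * dsym X)) :
  emb (terms_val ts) = poly_of_terms [seq (t.1, sym_mon t.2) | t <- ts].
Proof.
rewrite /emb /terms_val malg_lift_sum /poly_of_terms big_map.
by apply: eq_bigr => t _; rewrite malg_liftU.
Qed.

(** Terms are multiplied one by one; no collecting of coefficients is needed. *)
Lemma vd_terms (ts : seq (k * dsym X)) b :
  di_vd (terms_val ts) << 1 *g b >> = terms_val [seq (t.1, dsym_vd t.2 b) | t <- ts].
Proof.
rewrite /terms_val big_map; elim: ts => [|t ts IH].
  by rewrite !big_nil (linear_map0 (di_vd_linear _)).
rewrite !big_cons -{1}[<< t.1 *g t.2 >>]scale1r di_vd_linear scale1r IH.
by rewrite /di_vd bilin_extUU mulr1.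
Qed.

Lemma computable_binomial A (rA : coding k A) (m m' : 'X_{1..N}) :
  computable rA (rpoly k N) (fun=> 'X_[m] - 'X_[m']).
Proof.
apply: (@computable_ext _ _ _ _ _ (fun=> poly_of_terms [:: (1, m); (-1, m')])).
  by move=> x; rewrite /poly_of_terms big_cons big_seq1 scale1r scaleN1r.
apply: computable_poly_of; computability; try exact: computable_mon_const.
  exact: computable_f1.
by apply: computable_fopp; apply: computable_f1.
Qed.

Lemma computable_emb A (rA : coding k A) (ts : A -> seq (k * dsym X)) :
  computable rA rdterms ts -> computable rA (rpoly k N) (fun x => emb (terms_val (ts x))).
Proof.
move=> Hts; apply: (@computable_ext _ _ _ _ _
  (fun x => poly_of_terms [seq (t.1, sym_mon t.2) | t <- ts x])).
  by move=> x; rewrite emb_terms.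
apply: computable_poly_of; apply: computable_map Hts _; computability.
by apply: computable_sym_mon; computability.
Qed.

Lemma computable_element_gens A (rA : coding k A) (ts : A -> seq (k * dsym X)) :
  computable rA rdterms ts ->
  computable rA (rseq (rpoly k N)) (fun x => element_gens (terms_val (ts x))).
Proof.
move=> Hts; apply: computable_cons; first exact: computable_emb.
apply: computable_const_map => y; apply: (@computable_ext _ _ _ _ _
  (fun x => poly_of_terms [seq (t.1, sym_mon (dsym_vd t.2 (letter y))) | t <- ts x])).
  by move=> x; rewrite vd_terms emb_terms -map_comp.
apply: computable_poly_of; apply: computable_map Hts _; computability.
by apply: computable_vd_letter; computability.
Qed.

Lemma computable_gens A (rA : coding k A) (l : A -> seq (seq (k * dsym X))) :
  computable rA (rseq rdterms) l ->
  computable rA (rseq (rpoly k N)) (fun x => gens [seq terms_val ts | ts <- l x]).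
Proof.
move=> Hl; apply: computable_cat.
  by apply: computable_const_map => p; apply: computable_binomial.
apply: computable_flatten; apply: (@computable_ext _ _ _ _ _
  (fun x => [seq element_gens (terms_val ts) | ts <- l x])).
  by move=> x; rewrite -map_comp.
by apply: computable_map Hl _; apply: computable_element_gens; computability.
Qed.

Definition Id_subset (l l' : seq (seq (k * dsym X))) : bool :=
  all (fun ts => in_ideal (gens [seq terms_val ts' | ts' <- l']) (emb (terms_val ts))) l.

Lemma computable_Id_subset A (rA : coding k A) (l l' : A -> seq (seq (k * dsym X))) :
  computable rA (rseq rdterms) l -> computable rA (rseq rdterms) l' ->
  computable rA (rbool k) (fun x => Id_subset (l x) (l' x)).
Proof.
move=> Hl Hl'; apply: computable_all Hl _; apply: computable_in_ideal.
  by apply: computable_gens; apply: (computable_comp (f := fst) Hl'); computability.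
by apply: computable_emb; computability.
Qed.

Lemma Id_subsetP (S T : {fset D}) l l' :
  S =i [seq terms_val ts | ts <- l] -> T =i [seq terms_val ts | ts <- l'] ->
  reflect (forall f, Id S f -> Id T f) (Id_subset l l').
Proof.
move=> ES ET; apply: (iffP allP) => [sub f Sf I HI TI|sub ts tsl].
  apply: Sf => // s; rewrite ES => /mapP[ts /sub /in_idealP /ideal_gensP Is ->].
  by apply: Is => // t tl; apply: TI; rewrite ET.
apply/in_idealP/ideal_gensP => I HI TI; apply: sub => // [J HJ SJ|t].
  by apply: SJ; rewrite ES; apply: map_f.
by rewrite ET; apply: TI.
Qed.

Lemma rdterms_code (l : seq (seq (k * dsym X))) :
  rcode (c := rseq rdterms) [seq terms_code ts | ts <- l] l.
Proof.
elim: l => //= ts l IH; split=> //; elim: ts => //= t ts IHts; by split.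
Qed.

End Decision.

Theorem theorem35 (k : fieldType) (X : finType) :
  algorithmically_solvable k
    (fun (c : den k (TPair TFinSet TFinSet)) (ST : {fset Di k X} * {fset Di k X}) =>
       presents c.1 ST.1 /\ presents c.2 ST.2)
    (fun ST : {fset Di k X} * {fset Di k X} =>
       forall f : Di k X, Id ST.1 f <-> Id ST.2 f).
Proof.
have [p Hp] : computable (rpair (rseq (rdterms k X)) (rseq (rdterms k X))) (rbool k)
    (fun x => Id_subset x.1 x.2 && Id_subset x.2 x.1).
  by apply: computable_and; apply: computable_Id_subset; computability.
exists p => -[S T] [c d] /= [[l -> ES] [l' -> ET]].
have [b pb /= Eb] := Hp ([seq terms_code ts | ts <- l], [seq terms_code ts | ts <- l'])
  (l, l') (conj (rdterms_code l) (rdterms_code l')).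
exists b; split; first exact: pb.
rewrite Eb; split=> [/andP[/(Id_subsetP ES ET) ST /(Id_subsetP ET ES) TS] f|E].
  by split; [apply: ST | apply: TS].
by apply/andP; split; [apply/(Id_subsetP ES ET) | apply/(Id_subsetP ET ES)] => f /E.
Qed.
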